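(* In the block time-marching setting described in the context, let $u_e$ be the exact solution of the time-dependent problem, let $u_M^B$ and $\hat u_M^B$ be the functions with coefficient vectors $\boldsymbol{u}^B$ (exact solution of the block time-marching least-squares problems) and $\hat{\boldsymbol{u}}^B$ (numerical solution, with error $\delta u$ in the solution of the least-squares problems), respectively. Given $\epsilon>0$, assume that $$\|u_M^B(\boldsymbol{x},t)-u_e(\boldsymbol{x},t)\|_{L^2(\Omega\times[t_n,t_{n+1}])}\le\epsilon,\qquad\forall\, n=0,\dots,N_t-1.$$ Then there exist $N\in\mathbb{N}^+$ and $\alpha>0$ such that, when $N_t>N$, $$\mathbb{E}_{\delta u}\big[\|\hat u_M^B(\boldsymbol{x},t)-u_e(\boldsymbol{x},t)\|_{L^2}\big]\ \ge\ \alpha\,\mu\,\sqrt{N_t}\,\beta(N_t)-\epsilon\sqrt{N_t},$$ where the $L^2$ norm is over $\Omega\times[0,T]$ and $$\beta(x)=\begin{cases}1,&\text{if }\max_k|\lambda_k|\le 1\text{ and }1\notin\{\lambda_k\},\\ x,&\text{if }\max_k|\lambda_k|=1\text{ and }1\in\{\lambda_k\},\\ |\lambda_m|^{x/2},&\text{if }\max_k|\lambda_k|>1.\end{cases}$$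
   Context: Problem. $\mathcal{L}u=f$ on $\Omega\times[0,T]$, with boundary condition $\mathcal{B}u=g$ on $\partial\Omega\times[0,T]$ and initial condition $u(\cdot,0)=h$; $u$ is scalar, $\mathcal{L}$ is a linear differential operator, $\Omega\subset\mathbb{R}^{d_x}$ is compact. Approximation. $[0,T]$ is divided into $N_t$ time blocks $[t_{i-1},t_i)$, $i=1,\dots,N_t$, with $t_i=iT/N_t$; there is one spatial subdomain. On block $i$ there are $J_n$ random features $\phi_{i,j}(\boldsymbol{x},t)$, $j=1,\dots,J_n$, of the form $\sigma((\boldsymbol{k}^{x}_{i,j})^\top l(\boldsymbol{x})+k^t_{i,j}l_i(t)+b_{i,j})$ or $\sigma((\boldsymbol{k}^{x}_{i,j})^\top l(\boldsymbol{x})+b^x_{i,j})\,\sigma(k^t_{i,j}l_i(t)+b^t_{i,j})$ with fixed parameters, where $l$ is an affine map of $\Omega$ into $[-1,1]^{d_x}$ and $l_i$ is the affine map of $[t_{i-1},t_i]$ onto $[-1,1]$. The function with coefficient vector $\boldsymbol{u}=(\boldsymbol{u}_1,\dots,\boldsymbol{u}_{N_t})$, $\boldsymbol{u}_i\in\mathbb{R}^{J_n}$, is $u_M(\boldsymbol{x},t)=\sum_{i=1}^{N_t}\mathbf{1}_{[t_{i-1},t_i)}(t)\sum_{j=1}^{J_n}u_{i,j}\phi_{i,j}(\boldsymbol{x},t)$. Matrices. Let $\boldsymbol{x}_{i,1},\dots,\boldsymbol{x}_{i,Q_x}\in\Omega$ and $t_{i-1}=t_{i,0}<t_{i,1}<\dots<t_{i,Q_t}=t_i$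 be collocation points in block $i$. Put $\mathbf{\Phi}_i(t)=(\phi_{i,j}(\boldsymbol{x}_{i,q},t))_{q,j}\in\mathbb{R}^{Q_x\times J_n}$, $\mathbf{\Phi}_{i,0}=\mathbf{\Phi}_i(t_{i,0})$, $\mathbf{\Phi}_{i,1}=\mathbf{\Phi}_i(t_{i,Q_t})$, $\mathbf{L}_i(t)=(\mathcal{L}\phi_{i,j}(\boldsymbol{x}_{i,q},t))_{q,j}$, $\mathbf{L}_i=[\mathbf{L}_i(t_{i,0})^\top,\dots,\mathbf{L}_i(t_{i,Q_t-1})^\top]^\top$, $\tilde{\mathbf{A}}_i=[\mathbf{\Phi}_{i,0}^\top,\mathbf{L}_i^\top]^\top$, $\boldsymbol{h}=(h(\boldsymbol{x}_{1,q}))_q$, and let $\boldsymbol{f}_i$ be the vector of values of $f$ at $(\boldsymbol{x}_{i,q},t_{i,j})$, $0\le j\le Q_t-1$, ordered as the rows of $\mathbf{L}_i$. All $\tilde{\mathbf{A}}_i^\top\tilde{\mathbf{A}}_i$ are invertible. Block time-marching. $\boldsymbol{u}^B_1$ minimizes $\|\tilde{\mathbf{A}}_1\boldsymbol{u}-\tilde{\boldsymbol{b}}_1\|^2$ with $\tilde{\boldsymbol{b}}_1=[\boldsymbol{h}^\top,\boldsymbol{f}_1^\top]^\top$; for $i\ge2$, $\boldsymbol{u}^B_i$ minimizes $\|\tilde{\mathbf{A}}_i\boldsymbol{u}-\tilde{\boldsymbol{b}}_i\|^2$ with $\tilde{\boldsymbol{b}}_i=[(\mathbf{\Phi}_{i-1,1}\boldsymbol{u}^B_{i-1})^\top,\boldsymbol{f}_i^\top]^\top$;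 $\boldsymbol{u}^B$ is the concatenation of the $\boldsymbol{u}^B_i$. The numerical solution $\hat{\boldsymbol{u}}^B=(\hat{\boldsymbol{u}}^B_i)_i$ is obtained by adding the same perturbation $\delta u$ in every block: $\hat{\boldsymbol{u}}^B_1=\boldsymbol{u}^B_1+\delta u$ and, for $i\ge2$, $\hat{\boldsymbol{u}}^B_i=\delta u+(\tilde{\mathbf{A}}_i^\top\tilde{\mathbf{A}}_i)^{-1}\tilde{\mathbf{A}}_i^\top[(\mathbf{\Phi}_{i-1,1}\hat{\boldsymbol{u}}^B_{i-1})^\top,\boldsymbol{f}_i^\top]^\top$. Standing assumptions. The random features (in local block coordinates) are the same in all blocks, so that all the matrices $\mathbf{B}_i=(\tilde{\mathbf{A}}_i^\top\tilde{\mathbf{A}}_i)^{-1}\mathbf{\Phi}_{i,0}^\top\mathbf{\Phi}_{i-1,1}$ equal one matrix $\mathbf{B}\in\mathbb{R}^{J_n\times J_n}$; the block length $T/N_t$, the features and $\mathbf{B}$ do not depend on $N_t$. $\mathbf{B}$ is diagonalizable, with eigenvalues $\lambda_1,\dots,\lambda_{J_n}\in\mathbb{C}$ and corresponding eigenvectors $\boldsymbol{b}_1,\dots,\boldsymbol{b}_{J_n}$ forming an orthonormal (unitary) basis; $\lambda_m$ denotes an eigenvalue of largest modulus. $\delta u=\sum_{k=1}^{J_n}\delta u_k\boldsymbol{b}_k$, where the $\delta u_k$ are i.i.d. random variables with $\mathbb{E}[\delta u_k]=0$, $\mathbb{E}[|\delta u_k|]=\mu>0$, $\mathbb{E}[(\delta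 u_k)^2]=\delta^2>0$ (law independent of $N_t$). $\mathbb{E}_{\delta u}$ is the expectation over $\delta u$.
   Formalization: Added: Ω is the closure of its interior (for Ω a single point all L² norms vanish and the bound fails), and σ is C^m with m the order of the operator L (so that Lφ is defined; for discontinuous σ the features can vanish in L² and the bound fails). *)

(* Defs.v *)
From HB Require Import structures.
From mathcomp Require Import all_boot all_order all_algebra.
From mathcomp Require Import all_classical all_reals all_analysis.
From mathcomp Require Import complex.

Set Implicit Arguments.
Unset Strict Implicit.
Unset Printing Implicit Defensive.

Import Order.TTheory GRing.Theory Num.Theory.
Import numFieldNormedType.Exports.
Import ComplexField.Normc.

Local Open Scope classical_set_scope.
Local Open Scope ring_scope.

(* Lebesgue measure on R^n, carried by [n.-tuple R] (the library has the
   product sigma-algebra on tuples but no measure on it), as the n-fold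
   product of the Lebesgue measure on R. *)
Section LebesgueTuple.
Context {R : realType}.

Definition cons_pair n (p : R * n.-tuple R) : n.+1.-tuple R :=
  [tuple of p.1 :: p.2].

Lemma measurable_cons_pair n : measurable_fun setT (@cons_pair n).
Proof. exact: (measurable_cons measurable_fst measurable_snd). Qed.

Definition lebesgue_cons n
    (m : {sigma_finite_measure set (n.-tuple R) -> \bar R}) :=
  pushforward (lebesgue_measure \x m)%E (@cons_pair n).

Section LebesgueCons.
Variables (n : nat) (m : {sigma_finite_measure set (n.-tuple R) -> \bar R}).
Local Open Scope ereal_scope.

Let lebesgue_cons0 : lebesgue_cons m set0 = 0.
Proof. by rewrite /lebesgue_cons /pushforward preimage_set0 measure0. Qed.

Let lebesgue_cons_ge0 A : 0 <= lebesgue_cons m A.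
Proof. by rewrite /lebesgue_cons /pushforward; exact: measure_ge0. Qed.

Let lebesgue_cons_sigma_additive : semi_sigma_additive (lebesgue_cons m).
Proof.
move=> F mF tF mUF; rewrite /lebesgue_cons /pushforward preimage_bigcup.
have mpre A : measurable A -> measurable (@cons_pair n @^-1` A).
  by move=> mA; rewrite -[X in measurable X]setTI; exact: measurable_cons_pair.
apply: measure_semi_sigma_additive => [k| |].
- exact: mpre.
- apply/trivIsetP => /= i j _ _ ij; rewrite -preimage_setI.
  by move/trivIsetP : tF => /(_ _ _ _ _ ij) ->//; rewrite preimage_set0.
- by rewrite -preimage_bigcup; exact: mpre.
Qed.

HB.instance Definition _ := isMeasure.Build _ _ _ (lebesgue_cons m)
  lebesgue_cons0 lebesgue_cons_ge0 lebesgue_cons_sigma_additive.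

Let lebesgue_cons_sigma_finite : sigma_finite setT (lebesgue_cons m).
Proof.
have /sigma_finiteP[F [TF ndF Foo]] := sigma_finiteT (@lebesgue_measure R).
have /sigma_finiteP[G [TG ndG Goo]] := sigma_finiteT m.
pose uncons (t : n.+1.-tuple R) := (thead t, [tuple of behead t]).
have muncons : measurable_fun setT uncons.
  apply: measurable_fun_pair; first exact: (@measurable_tnth _ _ n.+1 ord0).
  exact: measurable_behead.
exists (fun k => uncons @^-1` (F k `*` G k)).
  rewrite -preimage_bigcup; apply/esym; rewrite -subTset => t _.
  have [i _ Fi] : (\bigcup_i F i) (uncons t).1 by rewrite -TF.
  have [j _ Gj] : (\bigcup_i G i) (uncons t).2 by rewrite -TG.
  exists (maxn i j) => //; split.
    by move: Fi; exact/subsetPset/ndF/leq_maxl.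
  by move: Gj; exact/subsetPset/ndG/leq_maxr.
move=> k; have [mF Fk] := Foo k; have [mG Gk] := Goo k; split.
  by rewrite -[X in measurable X]setTI; apply: muncons => //; exact: measurableX.
rewrite /lebesgue_cons /pushforward.
rewrite -comp_preimage (_ : uncons \o @cons_pair n = id) ?preimage_id.
  by rewrite product_measure1E// lte_mul_pinfty// ge0_fin_numE.
apply/funext => -[x t]; rewrite /uncons /cons_pair /= theadE.
by congr pair; exact/val_inj.
Qed.

HB.instance Definition _ := Measure_isSigmaFinite.Build _ _ _
  (lebesgue_cons m) lebesgue_cons_sigma_finite.
End LebesgueCons.

Fixpoint lebesgue_tuple n : {sigma_finite_measure set (n.-tuple R) -> \bar R} :=
  match n with
  | 0%N => \d_([tuple] : 0.-tuple R)
  | n'.+1 => lebesgue_cons (lebesgue_tuple n')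
  end.

End LebesgueTuple.

Notation spacetime R d := ('rV[R]_d * R)%type.

Section DifferentialOperator.
Context {R : realType} {d : nat}.
Local Notation ST := (spacetime R d).

(* [None] is the time direction, [Some k] the k-th space direction. *)
Definition axis (i : option 'I_d) : ST :=
  if i is Some k then (delta_mx 0 k, 0) else (0, 1).

Definition iter_partial (s : seq (option 'I_d)) (u : ST -> R) : ST -> R :=
  foldr (fun i v z => 'D_(axis i) v z) u s.

Fixpoint has_partial (s : seq (option 'I_d)) (u : ST -> R) (z : ST) : Prop :=
  if s is i :: s' then
    (\forall y \near z, has_partial s' u y) /\
    derivable (iter_partial s' u) z (axis i)
  else True.

(* The operator [u |-> \sum_k coef k * iter_partial (dirs k) u]. *)
Record diffop := DiffOp {
  nterms : nat;
  coef : 'I_nterms -> ST -> R;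
  dirs : 'I_nterms -> seq (option 'I_d) }.

Definition apply_diffop (L : diffop) (u : ST -> R) (z : ST) : R :=
  \sum_(k < nterms L) coef k z * iter_partial (dirs k) u z.

Definition diffop_order (L : diffop) : nat := \max_(k < nterms L) size (dirs k).

End DifferentialOperator.
Arguments diffop : clear implicits.

Section L2Norm.
Context {R : realType} {d : nat}.
Local Notation ST := (spacetime R d).

Definition of_tuple (p : d.-tuple R * R) : ST := (\row_k tnth p.1 k, p.2).

Definition cylinder (Omega : set 'rV[R]_d) (a b : R) : set (d.-tuple R * R) :=
  [set p | Omega (of_tuple p).1 /\ a <= p.2 <= b].

(* The norm of L^2(Omega x [a, b]) for complex-valued functions. *)
Definition L2norm (Omega : set 'rV[R]_d) (a b : R) (w : ST -> R[i]) : \bar R :=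
  'N[(lebesgue_tuple d \x lebesgue_measure)%E]_(2%:E)
    [(fun p => (normc (w (of_tuple p)))%:E) \_ (cylinder Omega a b)]%E.

End L2Norm.

Section Problem.
Context {R : realType} {d : nat}.
Local Notation ST := (spacetime R d).

(* The continuous problem together with the collocation points; the blocks are
   numbered from 0, so that block [n] is the time interval
   [n * tau, n.+1 * tau]. *)
Record problem := Problem {
  oper : diffop R d;
  boundary_oper : (ST -> R) -> ST -> R;
  source : ST -> R;
  boundary_data : ST -> R;
  initial_data : 'rV[R]_d -> R;
  Qx : nat;
  Qt : nat;
  xcol : nat -> 'I_Qx -> 'rV[R]_d;
  tcol : nat -> 'I_Qt.+1 -> R }.
Arguments xcol : clear implicits.
Arguments tcol : clear implicits.

(* The equation is imposed at the interior points, where the partial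
   derivatives of a function on Omega x [0, T] make sense. *)
Definition exact_solution (Omega : set 'rV[R]_d) (T : R) (pb : problem)
    (u : ST -> R) : Prop :=
  [/\ measurable_fun (cylinder Omega 0 T) (u \o of_tuple),
      (forall x t, Omega° x -> 0 < t < T ->
        (forall k : 'I_(nterms (oper pb)),
          has_partial (dirs k) u (x, t)) /\
        apply_diffop (oper pb) u (x, t) = source pb (x, t)),
      (forall x t, (closure Omega `\` Omega°) x -> 0 <= t <= T ->
        boundary_oper pb u (x, t) = boundary_data pb (x, t)) &
      (forall x, Omega x -> u (x, 0) = initial_data pb x)].

Definition collocation (Omega : set 'rV[R]_d) (tau : R) (pb : problem)
    (n : nat) : Prop :=
  [/\ (forall q, Omega (xcol pb n q)),
      tcol pb n ord0 = n%:R * tau,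
      tcol pb n ord_max = n.+1%:R * tau &
      (forall s s' : 'I_(Qt pb).+1, (s < s')%N -> tcol pb n s < tcol pb n s')].

End Problem.
Arguments problem : clear implicits.
Arguments xcol {R d}.
Arguments tcol {R d}.

Section RandomFeatures.
Context {R : realType} {d J : nat}.
Local Notation ST := (spacetime R d).

Variant feature :=
  | SpaceTime of 'rV[R]_d & R & R          (* kx, kt, b *)
  | Separated of 'rV[R]_d & R & R & R.     (* kx, bx, kt, bt *)

Definition eval_feature (sigma : R -> R) (p : feature) (x : 'rV[R]_d) (t : R) :=
  match p with
  | SpaceTime kx kt b => sigma ((x *m kx^T) 0 0 + kt * t + b)
  | Separated kx bx kt bt =>
      sigma ((x *m kx^T) 0 0 + bx) * sigma (kt * t + bt)
  end.

(* [xmap x = x *m lin + off] is the affine map l; the feature parameters carry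
   no block index because the features are the same in all the blocks in local
   coordinates. *)
Record rfm := RFM {
  tau : R;
  sigma : R -> R;
  lin : 'M[R]_d;
  off : 'rV[R]_d;
  param : 'I_J -> feature }.

Variable S : rfm.

Definition xmap (x : 'rV[R]_d) : 'rV[R]_d := x *m lin S + off S.

Definition tmap (n : nat) (t : R) : R := 2 * (t - n%:R * tau S) / tau S - 1.

Definition phi (n : nat) (j : 'I_J) : ST -> R :=
  fun z => eval_feature (sigma S) (param S j) (xmap z.1) (tmap n z.2).

Definition uM (Nt : nat) (c : nat -> 'cV[R[i]]_J) (z : ST) : R[i] :=
  \sum_(n < Nt) (\1_(`[n%:R * tau S, n.+1%:R * tau S[) z.2 : R)%:C%C *
    \sum_(j < J) c n j 0 * (phi n j z)%:C%C.

Section Matrices.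
Variables (pb : problem R d) (n : nat).

Definition Phi (t : R) : 'M[R]_(Qx pb, J) :=
  \matrix_(q, j) phi n j (xcol pb n q, t).

Definition Phi0 := Phi (tcol pb n ord0).
Definition Phi1 := Phi (tcol pb n ord_max).

Definition tcol_left (s : 'I_(Qt pb)) : R :=
  tcol pb n (widen_ord (leqnSn (Qt pb)) s).

Definition Lmat (t : R) : 'M[R]_(Qx pb, J) :=
  \matrix_(q, j) apply_diffop (oper pb) (phi n j) (xcol pb n q, t).

Definition Lblock : 'M[R]_(\sum_(s < Qt pb) Qx pb, J) :=
  \mxcol_(s < Qt pb) Lmat (tcol_left s).

Definition Atilde : 'M[R]_(Qx pb + \sum_(s < Qt pb) Qx pb, J) :=
  col_mx Phi0 Lblock.

Definition fvec : 'cV[R]_(\sum_(s < Qt pb) Qx pb) :=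
  \mxcol_(s < Qt pb) \col_q source pb (xcol pb n q, tcol_left s).

End Matrices.

Definition hvec (pb : problem R d) : 'cV[R]_(Qx pb) :=
  \col_q initial_data pb (xcol pb 0 q).

Definition btilde (pb : problem R d) (u : nat -> 'cV[R]_J) (n : nat) :=
  col_mx (if n is n'.+1 then Phi1 pb n' *m u n' else hvec pb) (fvec pb n).

Definition sqnorm m (v : 'cV[R]_m) : R := \sum_k v k 0 ^+ 2.

Definition least_squares m (A : 'M[R]_(m, J)) (b : 'cV[R]_m) (u : 'cV[R]_J) :=
  forall v, sqnorm (A *m u - b) <= sqnorm (A *m v - b).

Definition block_time_marching (Nt : nat) (pb : problem R d)
    (u : nat -> 'cV[R]_J) : Prop :=
  forall n, (n < Nt)%N -> least_squares (Atilde pb n) (btilde pb u n) (u n).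

Definition toC m k (A : 'M[R]_(m, k)) : 'M[R[i]]_(m, k) :=
  map_mx (real_complex R) A.

Definition pseudo_inverse m (A : 'M[R]_(m, J)) : 'M[R]_(J, m) :=
  invmx (A^T *m A) *m A^T.

(* The coefficients are complex because the error is a combination of possibly
   complex eigenvectors. *)
Fixpoint uhat (pb : problem R d) (u : nat -> 'cV[R]_J) (du : 'cV[R[i]]_J)
    (n : nat) : 'cV[R[i]]_J :=
  if n is n'.+1 then
    du + toC (pseudo_inverse (Atilde pb n)) *m
           col_mx (toC (Phi1 pb n') *m uhat pb u du n') (toC (fvec pb n))
  else toC (u 0%N) + du.

(* The matrix of the n-th transition, from block [n] to block [n.+1]. *)
Definition Bmat (pb : problem R d) (n : nat) : 'M[R]_J :=
  invmx ((Atilde pb n.+1)^T *m Atilde pb n.+1) *m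
    (Phi0 pb n.+1)^T *m Phi1 pb n.

End RandomFeatures.
Arguments feature : clear implicits.
Arguments rfm : clear implicits.

Definition Cn_regular (R : realType) (m : nat) (f : R -> R) : Prop :=
  (forall k, (k < m)%N -> forall y, derivable (derive1n k f) y 1) /\
  (forall k, (k <= m)%N -> continuous (derive1n k f)).

Definition orthonormal_eigenbasis (R : realType) (J : nat) (B : 'M[R]_J)
    (lam : 'I_J -> R[i]) (b : 'I_J -> 'cV[R[i]]_J) : Prop :=
  (forall k, toC B *m b k = lam k *: b k) /\
  (forall k l, \sum_i conjc (b k i 0) * b l i 0 = (k == l)%:R).

Section RandomVariables.
Context {R : realType} {J : nat} {dW : measure_display} {W : measurableType dW}.
Variables (P : probability W R) (X : 'I_J -> {RV P >-> R}).

Definition independent_family : Prop :=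
  forall (K : {set 'I_J}) (A : 'I_J -> set R), (forall k, measurable (A k)) ->
  P (\bigcap_(k in [set` K]) (X k @^-1` A k)) =
    (\prod_(k in K) P (X k @^-1` A k))%E.

Definition identically_distributed : Prop :=
  forall (k l : 'I_J) (A : set R), measurable A ->
  distribution P (X k) A = distribution P (X l) A.

End RandomVariables.

Section Beta.
Context {R : realType} {J : nat}.
Variables (lam : 'I_J -> R[i]) (m : 'I_J).

Definition max_modulus : R := \big[Order.max/0]_(k < J) normc (lam k).

(* [m] is meant to be the index of an eigenvalue of largest modulus; the last
   branch is reached exactly when [max_modulus > 1]. *)
Definition beta (x : R) : R :=
  if (max_modulus <= 1) && (1 \notin codom lam) then 1
  else if (max_modulus == 1) && (1 \in codom lam) then x
  else normc (lam m) `^ (x / 2).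

End Beta.

(* Main.v *)
Require Import Defs.
From HB Require Import structures.
From mathcomp Require Import all_boot all_order all_algebra.
From mathcomp Require Import all_classical all_reals all_analysis.
From mathcomp Require Import complex.
From mathcomp Require Import measurable_realfun ring lra.

Import Order.TTheory GRing.Theory Num.Theory.
Import numFieldNormedType.Exports.
Import ComplexField.Normc.

Local Open Scope classical_set_scope.
Local Open Scope ring_scope.

(** The coefficient error satisfies [e_0 = du] and [e_(n+1) = du + B e_n], so its
    coordinate along the eigenvector [b_k] is [du_k s_n(lambda_k)] with
    [s_n(l) = 1 + l + ... + l^n].  A combination of the features that vanishes on
    the interior of a block is annihilated by all the partial derivatives, hence
    by the injective matrix [Atilde]: the features are linearly independent on the
    interior.  Some [J] points of the interior therefore give an invertible
    evaluation matrix, and by continuity every combination with coefficients [e]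
    is at least [c |e|_1] on a whole ball of fixed radius around one of these
    points.  The features of the other blocks are translates, so [c] and the
    radius serve all blocks, and the squared L2 distance between the numerical and
    the exact block solutions is at least a constant times
    [|du_k|^2 \sum_(n < Nt) |s_n(lambda_k)|^2] for any chosen [k].  For a suitable
    [k] this sum grows at least like [Nt beta(Nt)^2].  Minkowski's inequality
    brings in [ue], and only [E|du_k| = mu] enters the final expectation. *)

(** * Iterated partial derivatives *)

Section PartialRegularity.
Context {R : realType} {d : nat}.
Local Notation ST := (spacetime R d).

(** All axis derivatives of length at most [m] exist everywhere and are continuous. The recursion
    peels off the innermost derivative, whereas [iter_partial] adds outermost ones;
    [partial_regular_iter] passes from one order to the other. *)
Fixpoint partial_regular (m : nat) (f : ST -> R) : Prop :=
  continuous f /\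
  if m is m'.+1 then
    forall i, (forall z, derivable f z (axis i)) /\
      partial_regular m' ('D_(axis i) f)
  else True.

Lemma partial_regular_continuous m f : partial_regular m f -> continuous f.
Proof. by case: m => [|m] []. Qed.

Lemma partial_regularW m f : partial_regular m.+1 f -> partial_regular m f.
Proof.
elim: m f => [|m IH] f [cf rf]; split=> // i.
by have [dfi rfi] := rf i; split=> //; exact: IH.
Qed.

Lemma partial_regular_leq m n f :
  (m <= n)%N -> partial_regular n f -> partial_regular m f.
Proof.
move=> /subnKC <-; elim: (n - m)%N => [|k IH]; first by rewrite addn0.
by rewrite addnS => /partial_regularW.
Qed.

Lemma partial_regular_cst m c : partial_regular m (cst c).
Proof.
elim: m c => [|m IH] c; split=> //; try exact: cst_continuous.
move=> i; split; first by move=> z; exact: derivable_cst.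
rewrite (_ : 'D_(axis i) (cst c) = cst 0); first exact: IH.
by apply/funext => z; rewrite derive_cst.
Qed.

Lemma partial_regularD m f g : partial_regular m f -> partial_regular m g ->
  partial_regular m (f \+ g).
Proof.
elim: m f g => [|m IH] f g [cf rf] [cg rg]; split=> //;
  try by move=> z; apply: continuousD; [exact: cf|exact: cg].
move=> i; have [dfi rfi] := rf i; have [dgi rgi] := rg i.
split; first by move=> z; exact: derivableD.
rewrite (_ : 'D_(axis i) (f \+ g) = 'D_(axis i) f \+ 'D_(axis i) g).
  exact: IH.
by apply/funext => z; rewrite deriveD.
Qed.

Lemma partial_regularM m f g : partial_regular m f -> partial_regular m g ->
  partial_regular m (f \* g).
Proof.
elim: m f g => [|m IH] f g rf rg; move: (rf) (rg) => [cf rf'] [cg rg'];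
  split=> //; try by move=> z; apply: continuousM; [exact: cf|exact: cg].
move=> i; have [dfi rfi] := rf' i; have [dgi rgi] := rg' i.
split; first by move=> z; exact: derivableM.
rewrite (_ : 'D_(axis i) (f \* g) =
  (f \* 'D_(axis i) g) \+ (g \* 'D_(axis i) f)).
  by apply: partial_regularD; apply: IH => //; exact: partial_regularW.
by apply/funext => z; rewrite deriveM.
Qed.

Lemma partial_regular_sum m n (f : 'I_n -> ST -> R) :
  (forall j, partial_regular m (f j)) ->
  partial_regular m (fun z => \sum_(j < n) f j z).
Proof.
elim: n f => [|n IH] f rf.
  rewrite (_ : (fun _ => _) = cst 0); first exact: partial_regular_cst.
  by apply/funext => z; rewrite big_ord0.
rewrite (_ : (fun _ => _) =
  (fun z => \sum_(j < n) f (widen_ord (leqnSn n) j) z) \+ f ord_max).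
  by apply: partial_regularD => //; exact: IH.
by apply/funext => z; rewrite big_ord_recr.
Qed.

Lemma Cn_regular_derive1 m (s : R -> R) :
  Cn_regular m.+1 s -> Cn_regular m (derive1 s).
Proof.
move=> [ds cs]; split=> k km.
  by rewrite -derive1Sn; exact: ds.
by rewrite -derive1Sn; exact: cs.
Qed.

(** The inner function [a] is affine along each axis with a slope [k] that depends on the axis only.
    The derivative of [s \o a] is thus [k] times [derive1 s \o a], a function of the same shape with
    one degree of regularity less. *)
Lemma partial_regular_comp m (s : R -> R) (a : ST -> R) :
  Cn_regular m s -> continuous a ->
  (forall i, exists k, forall z h, a (h *: axis i + z) = h * k + a z) ->
  partial_regular m (s \o a).
Proof.
move=> rs ca aff; elim: m s rs => [|m IH] s rs.
  split=> // z; apply: continuous_comp; first exact: ca.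
  exact: (rs.2 0%N).
split.
  move=> z; apply: continuous_comp; first exact: ca.
  exact: (rs.2 0%N).
move=> i; have [k ak] := aff i.
have dl z h : is_derive h (1 : R) (fun h : R => h * k + a z) k.
  rewrite (_ : (fun _ => _) = (k \*: id + cst (a z) : R -> R)).
    by apply: is_derive_eq; rewrite addr0 [_ *: _]mulr1.
  by apply/funext => y; rewrite mulrC.
(* Along the axis through [z] the composite is the one-variable function [h |-> s (h * k + a z)], to
   which the chain rule on the real line applies. *)
have dE z : derivable (s \o a) z (axis i) /\
    'D_(axis i) (s \o a) z = k * (derive1 s \o a) z.
  pose g := s \o (fun h : R => h * k + a z).
  have gE : (fun h : R => (s \o a) (h *: axis i + z)) = g.
    by apply/funext => h; rewrite /g /= ak.
  have dg : derivable g 0 1.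
    apply/derivable1_diffP; apply: differentiable_comp.
      by apply/derivable1_diffP; have [] := dl z 0.
    by apply/derivable1_diffP; apply: (rs.1 0%N).
  split; first by apply/derivable1P; rewrite gE.
  have -> : 'D_(axis i) (s \o a) z = 'D_1 g 0.
    rewrite /derive; set q1 := (fun _ : R => _); set q2 := (fun _ : R => _).
    suff -> : q1 = q2 by [].
    by apply/funext => h; rewrite /q1 /q2 /g /= ak [_%:A]mulr1 addr0 mul0r add0r.
  rewrite -derive1E derive1_comp; [|by have [] := dl z 0|exact: (rs.1 0%N)].
  rewrite mul0r add0r mulrC /=; congr (_ * _).
  by rewrite derive1E derive_val.
split; first by move=> z; have [] := dE z.
rewrite (_ : 'D_(axis i) (s \o a) = cst k \* (derive1 s \o a)).
  apply: partial_regularM; first exact: partial_regular_cst.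
  exact/IH/Cn_regular_derive1.
by apply/funext => z; have [] := dE z.
Qed.

Lemma partial_regular_iter s m f :
  partial_regular (size s + m) f -> partial_regular m (iter_partial s f).
Proof.
elim: s m => [|i s IH] m //= rf.
have [_ /(_ i)[]//] : partial_regular m.+1 (iter_partial s f).
by apply: IH; rewrite addnS -addSn.
Qed.

Lemma iter_partial_sum s n (v : 'I_n -> R) (f : 'I_n -> ST -> R) :
  (forall j, partial_regular (size s) (f j)) ->
  iter_partial s (fun z => \sum_(j < n) v j * f j z) =
  (fun z => \sum_(j < n) v j * iter_partial s (f j) z).
Proof.
elim: s => [|i s IH] rf //=.
rewrite IH; last by move=> j; exact: partial_regularW.
apply/funext => z.
have dj j : derivable (iter_partial s (f j)) z (axis i).
  have : partial_regular 1 (iter_partial s (f j)).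
    by apply: partial_regular_iter; rewrite addn1.
  by case=> _ /(_ i)[].
have -> : (fun z => \sum_(j < n) v j * iter_partial s (f j) z) =
    \sum_(j < n) (v j \*: iter_partial s (f j)).
  by apply/funext => y; rewrite fct_sumE.
rewrite derive_sum => [|j]; last exact: derivableZ.
by apply: eq_bigr => j _; rewrite deriveZ.
Qed.

(** Derivatives are local: around a point of the open set [X] the function coincides with the zero
    function. *)
Lemma iter_partial_eq0 s (g : ST -> R) (X : set ST) :
  open X -> (forall z, X z -> g z = 0) ->
  forall z, X z -> iter_partial s g z = 0.
Proof.
move=> oX; elim: s => [//|i s IH] g0 z Xz /=.
rewrite (@near_eq_derive _ _ _ _ (cst 0)).
  by rewrite derive_cst.
by near=> y; apply: IH => //; near: y; exact: open_nbhs_nbhs.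
Unshelve. all: by end_near.
Qed.

End PartialRegularity.

(** * Linear independence of the random features *)

(** The points are chosen one at a time. While there are fewer than [n] of them, some nonzero vector
    is killed by all the evaluations made so far; independence provides a point where the
    corresponding combination does not vanish, and evaluation there raises the rank. *)
Lemma independent_evaluations (F : fieldType) (T : Type) (X : set T) n
    (f : 'I_n -> T -> F) :
  (forall v : 'cV[F]_n,
     (forall z, X z -> \sum_j v j 0 * f j z = 0) -> v = 0) ->
  exists z : 'I_n -> T, (forall i, X (z i)) /\
    \matrix_(i, j) f j (z i) \in unitmx.
Proof.
move=> indep.
suff H k : (k <= n)%N -> exists z : 'I_k -> T, (forall i, X (z i)) /\
    \rank (\matrix_(i < k, j < n) f j (z i)) = k.
  have [z [Xz rz]] := H n (leqnn n); exists z; split=> //.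
  by rewrite -row_free_unit; apply/eqP.
elim: k => [_|k IH kn].
  have z0 : 'I_0 -> T by case.
  by exists z0; split; [case|apply/eqP; rewrite -leqn0 rank_leq_row].
have [z [Xz rz]] := IH (ltnW kn).
set M := \matrix_(i, j) _ in rz.
have /matrix0Pn[i0 [j0 cj0]] : cokermx M != 0.
  by rewrite -mxrank_eq0 mxrank_coker rz subn_eq0 -ltnNge.
pose v := col j0 (cokermx M).
have Mv : M *m v = 0 by rewrite /v colE mulmxA mulmx_coker mul0mx.
have [w Xw fw] : exists2 w, X w & \sum_j v j 0 * f j w != 0.
  apply: contrapT => nw; case/eqP: cj0.
  have /matrixP/(_ i0 0) : v = 0.
    apply: indep => y Xy; apply/eqP; apply: contra_notT nw => ny.
    by exists y.
  by rewrite !mxE.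
rewrite -addn1.
exists (fun i => match fintype.split i with inl i' => z i' | inr _ => w end); split.
  by move=> i; case: fintype.split.
pose r : 'rV[F]_n := \row_j f j w.
have -> : (\matrix_(i < k + 1, j < n)
    f j (match fintype.split i with inl i' => z i' | inr _ => w end)) = col_mx M r.
  by apply/matrixP => i j; rewrite !mxE; case: fintype.split => i'; rewrite !mxE.
apply/eqP; rewrite eqn_leq rank_leq_row -addsmxE addn1 -{1}rz.
apply: rank_ltmx; rewrite /ltmx addsmxSl /= addsmx_sub submx_refl /=.
(* If the new row were a combination of the old rows, it would kill [v] as they do. *)
apply/negP => /submxP[D rD]; case/eqP: fw.
have : (r *m v) 0 0 = 0 by rewrite rD -mulmxA Mv mulmx0 mxE.
rewrite mxE => rv; rewrite -[RHS]rv.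
by apply: eq_bigr => j _; rewrite !mxE mulrC.
Qed.

Section FeatureRegularity.
Context {R : realType} {d J : nat}.
Local Notation ST := (spacetime R d).

Lemma partial_regular_affine m (s : R -> R) (A : 'cV[R]_d) (c e : R) :
  Cn_regular m s ->
  partial_regular m (fun z : ST => s ((z.1 *m A) 0 0 + c * z.2 + e)).
Proof.
move=> rs; pose a := fun z : ST => (z.1 *m A) 0 0 + c * z.2 + e.
apply: (@partial_regular_comp _ _ _ s a) => //.
  have c1 : continuous (fun y : ST => (y.1 *m A) 0 0).
    rewrite (_ : (fun y : ST => (y.1 *m A) 0 0) =
      (fun x : 'rV[R]_d => \sum_k x 0 k * A k 0) \o fst); last first.
      by apply/funext => y; rewrite /= mxE.
    move=> y; apply: continuous_comp; first exact: cvg_fst.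
    apply: continuous_big => [|k _ {}y]; first exact: add_continuous.
    by apply: (@continuousM _ _ (fun x : 'rV[R]_d => x 0 k) (cst (A k 0)));
      [exact: coord_continuous|exact: cst_continuous].
  have c2 : continuous (fun y : ST => c * y.2).
    by move=> y; apply: cvgM; [exact: cvg_cst|exact: cvg_snd].
  by move=> z; apply: cvgD; [apply: cvgD; [exact: c1|exact: c2]|exact: cvg_cst].
move=> i; exists (((axis i : ST).1 *m A) 0 0 + c * (axis i : ST).2) => z h.
rewrite /a /= mulmxDl -scalemxAl !mxE; rewrite /GRing.scale /=; ring.
Qed.

Lemma partial_regular_phi m (S : rfm R d J) n j :
  Cn_regular m (sigma S) -> partial_regular m (phi S n j).
Proof.
move=> rs; rewrite /phi.
have affx (k : 'rV[R]_d) x :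
    (xmap S x *m k^T) 0 0 = (x *m (lin S *m k^T)) 0 0 + (off S *m k^T) 0 0.
  by rewrite /xmap mulmxDl mulmxA mxE.
have afft (k t : R) : k * tmap S n t =
    2 * k / tau S * t + k * (- (2 * (n%:R * tau S) / tau S) - 1).
  by rewrite /tmap; ring.
case: (param S j) => [kx kt b|kx bx kt bt] /=.
  rewrite (_ : (fun _ => _) = (fun z : ST => sigma S
     ((z.1 *m (lin S *m kx^T)) 0 0 + 2 * kt / tau S * z.2 +
      ((off S *m kx^T) 0 0 + kt * (- (2 * (n%:R * tau S) / tau S) - 1) + b)))).
    exact: partial_regular_affine.
  by apply/funext => z; congr sigma; rewrite affx afft; ring.
(* Each factor of a separated feature is an affine feature, with zero time coefficient for the first
   and zero space coefficients for the second. *)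
rewrite (_ : (fun _ => _) = (fun z : ST => sigma S
     ((z.1 *m (lin S *m kx^T)) 0 0 + 0 * z.2 + ((off S *m kx^T) 0 0 + bx))) \*
   (fun z : ST => sigma S
     ((z.1 *m (0 : 'cV[R]_d)) 0 0 + 2 * kt / tau S * z.2 +
      (kt * (- (2 * (n%:R * tau S) / tau S) - 1) + bt)))).
  by apply: partial_regularM; exact: partial_regular_affine.
apply/funext => z /=; congr (sigma S _ * sigma S _).
  by rewrite affx; ring.
by rewrite afft mulmx0 mxE; ring.
Qed.

Lemma open_spacetime_interior (Omega : set 'rV[R]_d) (T : R) :
  open [set z : ST | Omega° z.1 /\ 0 < z.2 < T].
Proof.
rewrite (_ : [set _ | _] = fst @^-1` Omega° `&` snd @^-1` `]0, T[).
  apply: openI; apply: open_comp => //; try by move=> z _; exact: cvg_fst.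
  - exact: open_interior.
  - by move=> z _; exact: cvg_snd.
by apply/seteqP; split=> z /=; rewrite in_itv.
Qed.

(** The open cylinder is dense in the closed one: space is approximated through
    [closure (Omega°) = Omega], time by moving slightly towards [T / 2]. *)
Lemma continuous_eq0_closure (Omega : set 'rV[R]_d) (T : R) (g : ST -> R) :
  closure (Omega°) = Omega -> 0 < T -> continuous g ->
  (forall z, Omega° z.1 /\ 0 < z.2 < T -> g z = 0) ->
  forall x t, Omega x -> 0 <= t <= T -> g (x, t) = 0.
Proof.
move=> hO T0 cg g0 x t Ox /andP[t0 tT].
have cl : closed [set z | g z = 0].
  apply: (@preimage_closed _ _ g [set 0]); last exact: closed_eq.
  by move=> z _; exact: cg.
suff cX : closure [set z : ST | Omega° z.1 /\ 0 < z.2 < T] (x, t).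
  have : closure [set z | g z = 0] (x, t) by exact: closureS cX.
  by rewrite -(closure_id _).1.
move=> U [[U1 U2] /= [nU1 nU2] UU].
rewrite -hO in Ox; have [y [Oy Uy]] := Ox _ nU1.
have [e /= e0 eU] := (nbhs_ballP _ _).1 nU2.
(* The bound [1 / 2] keeps the moved time strictly between [0] and [T]; the other bound keeps the
   move within the radius [e]. *)
pose s := Num.min (2^-1) (e / (2 * T)).
have s0 : 0 < s by rewrite lt_min invr_gt0 ltr0n divr_gt0 // mulr_gt0.
have s1 : s <= 2^-1 by rewrite ge_min lexx.
have s2 : s * T <= e / 2.
  have : s <= e / (2 * T) by rewrite ge_min lexx orbT.
  by rewrite invfM mulrA ler_pdivlMr.
exists (y, t + s * (T / 2 - t)); split=> /=; first split=> //.
  by apply/andP; split; nra.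
apply: UU; split=> //=; apply: eU.
rewrite /ball /= ltr_norml; apply/andP; split; nra.
Qed.

(** Collocation points may lie on the boundary of [Omega] or at an end of the time block, outside
    the open set where the derivatives are known to vanish; continuity of the derivatives up to the
    order of the operator reaches them. *)
Lemma features_independent (Omega : set 'rV[R]_d) (S : rfm R d J)
    (pb : problem R d) (v : 'cV[R]_J) :
  closure (Omega°) = Omega -> 0 < tau S -> collocation Omega (tau S) pb 0 ->
  Cn_regular (diffop_order (oper pb)) (sigma S) ->
  (Atilde S pb 0)^T *m Atilde S pb 0 \in unitmx ->
  (forall z, Omega° z.1 /\ 0 < z.2 < tau S ->
     \sum_j v j 0 * phi S 0 j z = 0) ->
  v = 0.
Proof.
move=> hO tau0 [xO t0 t1 tmono] rs hA v0.
pose X : set (spacetime R d) := [set z | Omega° z.1 /\ 0 < z.2 < tau S].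
have oX : open X by exact: open_spacetime_interior.
have tI s : 0 <= tcol pb 0 s <= tau S.
  have le (s1 s2 : 'I_(Qt pb).+1) : (s1 <= s2)%N -> tcol pb 0 s1 <= tcol pb 0 s2.
    by rewrite leq_eqVlt => /predU1P[/ord_inj->//|/tmono/ltW].
  rewrite mul0r in t0; rewrite mul1r in t1.
  by rewrite -{1}t0 -t1 !le //; exact: leq_ord.
have vanish s : (size s <= diffop_order (oper pb))%N ->
    forall x t, Omega x -> 0 <= t <= tau S ->
    \sum_j v j 0 * iter_partial s (phi S 0 j) (x, t) = 0.
  move=> ss; have rphi j : partial_regular (size s) (phi S 0 j).
    exact: partial_regular_leq ss (partial_regular_phi _ _ _ _ rs).
  apply: (@continuous_eq0_closure Omega _
    (fun z => \sum_j v j 0 * iter_partial s (phi S 0 j) z)) => //.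
    rewrite -(iter_partial_sum s _ (fun j => v j 0) (phi S 0)) //.
    apply: (@partial_regular_continuous _ _ 0).
    apply: partial_regular_iter; rewrite addn0; apply: partial_regular_sum => j.
    by apply: partial_regularM => //; exact: partial_regular_cst.
  move=> z Xz.
  have := iter_partial_sum s _ (fun j => v j 0) (phi S 0) rphi.
  move=> /(congr1 (fun f => f z)) <-.
  exact: (iter_partial_eq0 s _ X oX).
(* The rows of [Phi0] are the case of no derivative; the rows of [Lblock] are combinations of the
   derivatives occurring in the operator. *)
have Av : Atilde S pb 0 *m v = 0.
  rewrite /Atilde mul_col_mx (_ : Phi0 S pb 0 *m v = 0); last first.
    apply/matrixP => q k; rewrite ord1 !mxE.
    rewrite -[RHS](vanish [::] _ (Defs.xcol pb 0 q) _ (xO q) (tI ord0)) //.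
    by apply: eq_bigr => j _; rewrite !mxE mulrC.
  rewrite /Lblock mxcol_mul (_ : (\mxcol__ _) = 0) ?col_mx0 //.
  rewrite -(mxcol0 (p_ := fun=> Qx pb)); apply: eq_mxcol => s.
  apply/matrixP => q k; rewrite ord1 !mxE.
  under eq_bigr => j _ do rewrite !mxE /apply_diffop mulr_suml.
  rewrite exchange_big big1 //= => k' _.
  under eq_bigr => j _ do rewrite -mulrA [_ * v j 0]mulrC.
  rewrite -mulr_sumr vanish ?mulr0 //; try exact: tI.
  exact: (@leq_bigmax _ (fun i : 'I_(nterms (oper pb)) => size (dirs i)) k').
by rewrite -(mulKmx hA v) -mulmxA Av !mulmx0.
Qed.

End FeatureRegularity.

(** * Modulus of complex numbers *)

Section Normc.
Context {R : realType}.

Lemma normc_real (x : R) : normc x%:C%C = `|x|.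
Proof. by rewrite /normc /= expr0n /= addr0 sqrtr_sqr. Qed.

Lemma normc_ge0 (x : R[i]) : 0 <= normc x.
Proof. by case: x => a b; rewrite /normc sqrtr_ge0. Qed.

Lemma normc_sum (I : Type) (s : seq I) (F : I -> R[i]) :
  normc (\sum_(i <- s) F i) <= \sum_(i <- s) normc (F i).
Proof.
elim: s => [|i s IH]; first by rewrite !big_nil normc0.
by rewrite !big_cons (le_trans (le_normcD _ _)) // lerD2l.
Qed.

End Normc.

(** * Lower bounds on balls for independent continuous functions *)

Section LocalLowerBound.
Context {R : realType} {V : normedModType R} {n : nat}.

(** Invertibility of the evaluation matrix bounds the coefficients by the largest value at the
    points [z i], and continuity extends this bound to balls. Only the index [i] depends on the
    coefficients. The index [i0] makes the maximum over the points meaningful. *)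
Lemma independent_local_lower_bound (X : set V) (f : 'I_n -> V -> R)
    (i0 : 'I_n) :
  open X -> (forall j, continuous (f j)) ->
  (forall v : 'cV[R]_n,
     (forall z, X z -> \sum_j v j 0 * f j z = 0) -> v = 0) ->
  exists (z : 'I_n -> V) (r c : R), [/\ 0 < r, 0 < c,
    forall i, ball (z i) r `<=` X &
    forall e : 'I_n -> R[i], exists i, forall y, ball (z i) r y ->
      c * \sum_j normc (e j) <= normc (\sum_j e j * (f j y)%:C%C)].
Proof.
move=> oX cf /independent_evaluations[z [Xz uz]].
set M := \matrix_(_, _) _ in uz.
(* [K] bounds the sum of the moduli of the coefficients by the largest modulus of a value; the added
   1 makes it positive. *)
pose K := 1 + \sum_j \sum_i `|invmx M j i|.
have K0 : 0 < K.
  by rewrite ltr_pwDl // sumr_ge0 // => j _; rewrite sumr_ge0.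
(* If each function varies by less than [eta] on a ball, the combination loses at most half of its
   value at the best point. The same [eta] serves as the final constant. *)
pose eta := (2 * K)^-1.
have eta0 : 0 < eta by rewrite invr_gt0 mulr_gt0.
have near_z i : \forall r \near 0^'+, ball (z i) r `<=`
    X `&` [set y | forall j, `|f j (z i) - f j y| < eta].
  have : nbhs (z i) (X `&` [set y | forall j, `|f j (z i) - f j y| < eta]).
    apply: filterI; first exact: open_nbhs_nbhs.
    apply: filter_forall => j.
    by have /cvgr_dist_lt/(_ _ eta0) := cf j (z i).
  move=> /nbhs_ballP[e /= e0 eX].
  near=> r; apply: subset_trans eX; apply: le_ball.
  by apply/ltW; near: r; exact: nbhs_right_lt.
have [r [r0 hr]] : exists r, 0 < r /\ forall i, ball (z i) r `<=`
    X `&` [set y | forall j, `|f j (z i) - f j y| < eta].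
  have [r [r0 hr]] := filter_ex (filterI (nbhs_right_gt 0) (filter_forall _ near_z)).
  by exists r.
exists z, r, eta; split=> //; first by move=> i y /hr[].
move=> e; pose u y := \sum_j e j * (f j y)%:C%C.
pose i := [arg max_(i > i0) normc (u (z i))]%O.
have umax k : normc (u (z k)) <= normc (u (z i)).
  by rewrite /i; case: arg_maxP => // l _; exact.
have eE j : e j = \sum_k (invmx M j k)%:C%C * u (z k).
  have : map_mx (real_complex R) (invmx M) *m
      (map_mx (real_complex R) M *m \col_k e k) = \col_k e k.
    by rewrite mulmxA -map_mxM mulVmx // map_mx1 mul1mx.
  move=> /matrixP/(_ j 0); rewrite !mxE => {1}<-; apply: eq_bigr => k _.
  rewrite !mxE; congr (_ * _); apply: eq_bigr => l _.
  by rewrite !mxE mulrC.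
have e1 : \sum_j normc (e j) <= K * normc (u (z i)).
  apply: (@le_trans _ _ (\sum_j \sum_k `|invmx M j k| * normc (u (z i)))).
    apply: ler_sum => j _; rewrite {1}eE (le_trans (normc_sum _ _ _)) //.
    by apply: ler_sum => k _; rewrite normcM normc_real ler_wpM2l.
  under eq_bigr => j _ do rewrite -mulr_suml.
  by rewrite -mulr_suml ler_wpM2r ?normc_ge0 // lerDr.
exists i => y /hr[_ hy].
have ule : normc (u (z i)) <= normc (u y) + eta * \sum_j normc (e j).
  have -> : u (z i) = u y + \sum_j e j * (f j (z i) - f j y)%:C%C.
    rewrite /u -big_split /=; apply: eq_bigr => j _.
    by rewrite rmorphB /= mulrBr addrC subrK.
  rewrite (le_trans (le_normcD _ _)) // lerD2l (le_trans (normc_sum _ _ _)) //.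
  rewrite mulr_sumr ler_sum // => j _.
  rewrite normcM normc_real mulrC ler_wpM2r ?normc_ge0 //.
  exact/ltW.
have etaK : eta * K = 2^-1 by rewrite /eta; field; rewrite gt_eqF.
(* With [s] the sum of the moduli, the value at [z i] is at least [2 * eta * s], and at most
   [eta * s] of it is lost at [y]. *)
have : eta * \sum_j normc (e j) <= 2^-1 * normc (u (z i)).
  by rewrite -etaK -mulrA ler_pM2l.
rewrite -/(u y); lra.
Unshelve. all: by end_near.
Qed.

End LocalLowerBound.

(** * Propagation and growth of the error *)

Section ErrorPropagation.
Context {R : realType} {d J : nat}.

Lemma toCM m n p (A : 'M[R]_(m, n)) (B : 'M[R]_(n, p)) :
  toC (A *m B) = toC A *m toC B.
Proof. exact: map_mxM. Qed.

(** The vector [v] given by the pseudo-inverse solves the normal equations, so its residual is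
    orthogonal to the range of [A]. By Pythagoras a minimizer [u] has [A *m (u - v) = 0], and [A] is
    injective. *)
Lemma least_squaresE m (A : 'M[R]_(m, J)) b u :
  A^T *m A \in unitmx -> least_squares A b u -> u = pseudo_inverse A *m b.
Proof.
move=> uA /(_ (pseudo_inverse A *m b)); set v := pseudo_inverse A *m b => uv.
pose w := u - v; pose r := A *m v - b.
have Ar : A^T *m r = 0.
  by rewrite /r mulmxBr mulmxA /v /pseudo_inverse !mulmxA mulmxV // mul1mx subrr.
have uE : A *m u - b = r + A *m w.
  by rewrite /r /w mulmxBr [RHS]addrC addrA subrK.
have orth : \sum_k r k 0 * (A *m w) k 0 = 0.
  have : ((A *m w)^T *m r) 0 0 = 0 by rewrite trmx_mul -mulmxA Ar mulmx0 mxE.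
  rewrite mxE => rw; rewrite -[RHS]rw; apply: eq_bigr => k _.
  by rewrite !mxE mulrC.
have Aw0 : sqnorm (A *m w) <= 0.
  move: uv; rewrite uE -/r.
  have -> : sqnorm (r + A *m w) = sqnorm r + sqnorm (A *m w) +
      2 * \sum_k r k 0 * (A *m w) k 0.
    rewrite /sqnorm mulr_sumr -!big_split /=; apply: eq_bigr => k _.
    by rewrite [(r + A *m w) k 0]mxE; ring.
  by rewrite orth mulr0 addr0 gerDl.
have Aw : A *m w = 0.
  apply/matrixP => k j; rewrite ord1 [RHS]mxE; apply/eqP.
  rewrite -sqrf_eq0 eq_le sqr_ge0 andbT (le_trans _ Aw0) //.
  by rewrite /sqnorm (bigD1 k) //= lerDl sumr_ge0 // => i _; rewrite sqr_ge0.
apply/eqP; rewrite -subr_eq0; apply/eqP; rewrite -/w.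
by rewrite -(mulKmx uA w) -mulmxA Aw !mulmx0.
Qed.

(** The [n.+1] terms account for the perturbations made in the blocks [0] to [n]. *)
Definition geometric_sum (l : R[i]) (n : nat) : R[i] := \sum_(i < n.+1) l ^+ i.

Lemma geometric_sum0 l : geometric_sum l 0 = 1.
Proof. by rewrite /geometric_sum big_ord1. Qed.

Lemma geometric_sumS l n :
  geometric_sum l n.+1 = 1 + l * geometric_sum l n.
Proof.
rewrite /geometric_sum big_ord_recl mulr_sumr; congr (_ + _).
by apply: eq_bigr => i _; rewrite exprS.
Qed.

Lemma uhat_error (S : rfm R d J) (pb : problem R d) (uB : nat -> 'cV[R]_J) Nt
    (B : 'M[R]_J) (lam : 'I_J -> R[i]) (b : 'I_J -> 'cV[R[i]]_J)
    (a : 'I_J -> R[i]) :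
  (forall n, (n < Nt)%N -> (Atilde S pb n)^T *m Atilde S pb n \in unitmx) ->
  (forall n, (n.+1 < Nt)%N -> Bmat S pb n = B) ->
  (forall k, toC B *m b k = lam k *: b k) ->
  block_time_marching S Nt pb uB ->
  forall n, (n < Nt)%N ->
  uhat S pb uB (\sum_k a k *: b k) n - toC (uB n) =
    \sum_k (a k * geometric_sum (lam k) n) *: b k.
Proof.
move=> hA hB hb hu; elim=> [|n IH] nN.
  rewrite /= addrC addKr; apply: eq_bigr => k _.
  by rewrite geometric_sum0 mulr1.
have uE := least_squaresE _ _ _ _ (hA _ nN) (hu _ nN).
have {IH} := IH (ltnW nN).
set e := \sum_k (a k * geometric_sum (lam k) n) *: b k => IH.
have -> : uhat S pb uB (\sum_k a k *: b k) n.+1 - toC (uB n.+1) =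
    \sum_k a k *: b k + toC B *m e.
  rewrite -IH uE [LHS]/= -addrA; congr (_ + _).
  (* The source parts of the two right-hand sides cancel, so only the rows of [Phi0] see the
     interface error, and they turn it into [B] times the previous error. *)
  rewrite -(hB _ nN) /Bmat /btilde [toC (_ *m col_mx _ _)]toCM.
  rewrite [toC (col_mx _ _)]map_col_mx -!/(toC _) -mulmxBr opp_col_mx add_col_mx.
  rewrite subrr !toCM -mulmxBr -!mulmxA; congr (_ *m _).
  rewrite /Atilde tr_col_mx [toC (row_mx _ _)]map_row_mx mul_row_col mulmx0.
  by rewrite addr0.
rewrite /e mulmx_sumr -big_split /=; apply: eq_bigr => k _.
by rewrite -scalemxAr hb scalerA -scalerDl geometric_sumS; congr (_ *: _); ring.
Qed.

(** The coordinate along [b k] is the Hermitian product of [b k] with the combination. The added 1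
    makes the constant positive, so that it can be divided by. *)
Lemma orthonormal_coord_le (b : 'I_J -> 'cV[R[i]]_J) (a : 'I_J -> R[i]) k :
  (forall k l, \sum_i conjc (b k i 0) * b l i 0 = (k == l)%:R) ->
  normc (a k) <=
    (1 + \sum_i normc (b k i 0)) *
    \sum_i normc ((\sum_l a l *: b l) i 0).
Proof.
move=> hb; set e := \sum_l a l *: b l.
have -> : a k = \sum_i conjc (b k i 0) * e i 0.
  under eq_bigr => i _ do rewrite summxE mulr_sumr.
  rewrite exchange_big /= (bigD1 k) //= [X in _ + X]big1 ?addr0 => [|l lk].
    transitivity (a k * \sum_i conjc (b k i 0) * b k i 0).
      by rewrite hb eqxx mulr1.
    by rewrite mulr_sumr; apply: eq_bigr => i _; rewrite mxE mulrCA.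
  transitivity (a l * \sum_i conjc (b k i 0) * b l i 0).
    by rewrite mulr_sumr; apply: eq_bigr => i _; rewrite mxE mulrCA.
  by rewrite hb eq_sym (negbTE lk) mulr0.
rewrite (le_trans (normc_sum _ _ _)) // mulr_sumr ler_sum // => i _.
have -> : normc (conjc (b k i 0) * e i 0) = normc (b k i 0) * normc (e i 0).
  by rewrite normcM; congr (_ * _); case: (b k i 0) => x y /=; rewrite sqrrN.
rewrite ler_wpM2r ?normc_ge0 // (bigD1 i) //= addrCA lerDl.
by rewrite addr_ge0 // sumr_ge0 // => j _; rewrite normc_ge0.
Qed.

End ErrorPropagation.

(** * Growth of the summed squares of the error factors *)

Section Growth.
Context {R : realType} {J : nat}.

Local Notation energy l N := (\sum_(n < N) normc (geometric_sum l n) ^+ 2).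

(* Since [s_(n+1) - l s_n = 1], two consecutive sums cannot both be small. *)
Lemma energy_ge_linear (l : R[i]) N : normc l <= 1 -> (1 < N)%N ->
  8^-1 * N%:R <= energy l N.
Proof.
move=> l1; case: N => // N N0.
(* Half of the last square is carried along: two consecutive squares add up to at least [1 / 2], and
   half of this pays for each increment of [1 / 4]. *)
have H : N%:R / 4 + normc (geometric_sum l N) ^+ 2 / 2 <= energy l N.+1.
  elim: N {N0} => [|N IH].
    rewrite big_ord_recl big_ord0 geometric_sum0 normc1; lra.
  rewrite big_ord_recr /=.
  have : 1 <= normc (geometric_sum l N.+1) + normc (geometric_sum l N).
    have := le_normcD (geometric_sum l N.+1) (- l * geometric_sum l N).
    rewrite {1}geometric_sumS mulNr addrK normc1 normcN normcM.
    have := normc_ge0 (geometric_sum l N); nra.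
  move: IH; rewrite -[N.+1%:R]natr1; set x := normc _; set y := normc _.
  move=> IH xy; have : 1 <= 2 * (x ^+ 2 + y ^+ 2).
    have : 0 <= (x - y) ^+ 2 by rewrite sqr_ge0.
    have := normc_ge0 (geometric_sum l N); have := normc_ge0 (geometric_sum l N.+1).
    rewrite -/x -/y; nra.
  lra.
apply: le_trans H; rewrite -[N.+1%:R]natr1.
have : 1 <= N%:R :> R by rewrite ler1n.
have : 0 <= normc (geometric_sum l N) ^+ 2 by rewrite sqr_ge0.
lra.
Qed.

(** For the eigenvalue 1 the sums are [n.+1], and [(N + 1)^3 - N^3 <= 3 (N + 1)^2]. The cube is [N]
    times the square of the branch [x] of [beta]. *)
Lemma energy1_ge_cubic N : 3^-1 * N%:R ^+ 3 <= energy (1 : R[i]) N.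
Proof.
have gE n : geometric_sum (1 : R[i]) n = (n.+1%:R : R)%:C%C.
  rewrite /geometric_sum; under eq_bigr do rewrite expr1n.
  by rewrite sumr_const card_ord rmorph_nat.
elim: N => [|N IH]; first by rewrite big_ord0 expr0n mulr0.
rewrite big_ord_recr /= gE normc_real ger0_norm // -[N.+1%:R]natr1.
have : 0 <= N%:R :> R by [].
nra.
Qed.

(** The last term alone suffices: its square is of order [normc l ^+ (2 * N)]. One factor
    [normc l ^+ N] is kept and Bernoulli's inequality turns the other into a multiple of [N]. *)
Lemma energy_ge_exponential (l : R[i]) : 1 < normc l ->
  exists2 N0 : nat, (0 < N0)%N & forall N, (N0 < N)%N ->
    (normc l - 1) / (4 * (normc l + 1) ^+ 2) * (N%:R * normc l ^+ N) <=
    energy l N.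
Proof.
move=> l1; set r := normc l in l1 *.
have bern n : n%:R * (r - 1) + 1 <= r ^+ n.
  elim: n => [|n IH]; first by rewrite mul0r add0r expr0.
  have n0 : 0 <= n%:R :> R by [].
  have := mulr_ge0 n0 (sqr_ge0 (r - 1)).
  have := ler_wpM2l (ltW (lt_trans ltr01 l1)) IH.
  rewrite -[n.+1%:R]natr1 [r ^+ n.+1]exprS; move: (r ^+ n) => t; lra.
(* Beyond this threshold Bernoulli's inequality gives a power at least 2, so that subtracting 1 from
   it leaves at least half. *)
have /archi_boundP : 0 <= (r - 1)^-1 by rewrite invr_ge0 subr_ge0 ltW.
set N0 := Num.bound _ => hN0.
exists N0.+1 => // -[//|N] /ltnW N0N.
have rN2 : 2 <= r ^+ N.+1.
  have : 1 <= N.+1%:R * (r - 1).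
    rewrite -ler_pdivrMr ?subr_gt0 // div1r (le_trans (ltW hN0)) // ler_nat.
    exact: ltnW.
  have := bern N.+1; lra.
have last_term : r ^+ N.+1 / (2 * (r + 1)) <= normc (geometric_sum l N).
  have gl : (l - 1) * geometric_sum l N = l ^+ N.+1 - 1.
    by rewrite subrX1.
  have nl : normc (l - 1) <= r + 1.
    by rewrite (le_trans (le_normcD _ _)) // normcN normc1.
  have ng : r ^+ N.+1 - 1 <= normc (l - 1) * normc (geometric_sum l N).
    rewrite -normcM gl lerBlDr.
    have -> : r ^+ N.+1 = normc (l ^+ N.+1).
      by elim: N.+1 => [|n IH]; rewrite ?expr0 ?normc1 // !exprS IH normcM.
    by rewrite -[X in normc X](subrK 1) (le_trans (le_normcD _ _)) // normc1.
  rewrite ler_pdivrMr; last lra.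
  have := normc_ge0 (geometric_sum l N); nra.
apply: (@le_trans _ _ ((r ^+ N.+1 / (2 * (r + 1))) ^+ 2)).
  have := bern N.+1; set t := r ^+ N.+1; set k := N.+1%:R => tk.
  have -> : (t / (2 * (r + 1))) ^+ 2 = t / (4 * (r + 1) ^+ 2) * t.
    by field; rewrite gt_eqF //; lra.
  rewrite [leLHS](_ : _ = t / (4 * (r + 1) ^+ 2) * (k * (r - 1))); last by ring.
  rewrite ler_wpM2l //; last lra.
  by rewrite divr_ge0 ?mulr_ge0 ?sqr_ge0 // /t; lra.
rewrite big_ord_recr /= (@le_trans _ _ (normc (geometric_sum l N) ^+ 2)) //.
  rewrite lerXn2r // ?nnegrE ?normc_ge0 //.
  by rewrite divr_ge0 //; lra.
by rewrite lerDr sumr_ge0 // => i _; rewrite sqr_ge0.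
Qed.

(** The eigendirection to observe depends on the branch of [beta]: that of an eigenvalue of largest
    modulus in the outer two branches, that of an eigenvalue equal to 1 in the middle one. *)
Lemma energy_growth (lam : 'I_J -> R[i]) (m : 'I_J) :
  (forall k, normc (lam k) <= normc (lam m)) ->
  exists (N0 : nat) (a : R) (k : 'I_J), [/\ (0 < N0)%N, 0 < a &
    forall N, (N0 < N)%N ->
      a * N%:R * beta lam m N%:R ^+ 2 <= energy (lam k) N].
Proof.
move=> hm.
have le_max k : normc (lam k) <= max_modulus lam by exact: le_bigmax.
have max_le : max_modulus lam <= normc (lam m).
  by apply: bigmax_le => //; exact: normc_ge0.
have [/[dup] c1 /andP[max1 _]|nc1] :=
    boolP ((max_modulus lam <= 1) && (1 \notin codom lam)).
  exists 1%N, 8^-1, m; split=> // N N1; rewrite /beta c1 expr1n mulr1.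
  by apply: energy_ge_linear => //; exact: le_trans (le_max m) max1.
have [/[dup] c2 /andP[_ /codomP[k lk]]|nc2] :=
    boolP ((max_modulus lam == 1) && (1 \in codom lam)).
  exists 1%N, 3^-1, k; split=> // N _.
  by rewrite /beta (negbTE nc1) c2 -lk -mulrA -exprS energy1_ge_cubic.
(* If all moduli were at most 1, failure of the first branch would make 1 an eigenvalue, hence the
   maximum equal to 1, which is the second branch. *)
have l1 : 1 < normc (lam m).
  apply: lt_le_trans max_le; rewrite ltNge; apply: contra nc2 => max1.
  move: nc1; rewrite max1 /= negbK => c1; rewrite c1 andbT eq_le max1 /=.
  by have /codomP[k lk] := c1; have := le_max k; rewrite -lk normc1.
have [N0 N00 hN] := energy_ge_exponential _ l1.
exists N0, ((normc (lam m) - 1) / (4 * (normc (lam m) + 1) ^+ 2)), m.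
split=> //.
  by rewrite divr_gt0 ?subr_gt0 // mulr_gt0 // exprn_gt0 // addr_gt0 // (lt_trans _ l1).
move=> N /hN; apply: le_trans; rewrite /beta (negbTE nc1) (negbTE nc2).
(* Squaring cancels the half in the exponent of [beta]. *)
rewrite -powR_mulrn ?powR_ge0 // -powRrM divfK ?pnatr_eq0 //.
by rewrite powR_mulrn ?normc_ge0 // [leRHS]mulrA.
Qed.

End Growth.

(** * Measurability and L2 estimates *)

Section TupleMeasurability.
Context {R : realType} {d : nat}.
Local Notation ST := (spacetime R d).
Local Notation TT := (d.-tuple R * R)%type.

(** The norm on space-time is a supremum norm, so a ball is a product of intervals. *)
Lemma of_tuple_ballE (z : ST) (r : R) : 0 < r ->
  of_tuple @^-1` ball z r =
  [set p : TT | (forall k, ball (z.1 0 k) r (tnth p.1 k)) /\ ball z.2 r p.2].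
Proof.
move=> r0; apply/seteqP; split=> p.
  move=> [[_ b1] b2]; split=> // k.
  by have := b1 0 k; rewrite /= mxE.
move=> [b1 b2]; split=> //; split=> // i k.
by rewrite ord1 /= mxE.
Qed.

Lemma measurable_tuple_box (y : 'I_d -> R) (r : R) :
  measurable [set t : d.-tuple R | forall k, ball (y k) r (tnth t k)].
Proof.
rewrite (_ : [set _ | _] =
  \bigcap_(k in [set: 'I_d]) ((fun t : d.-tuple R => tnth t k) @^-1` ball (y k) r)).
  apply: fin_bigcap_measurable => // k _.
  rewrite -[X in measurable X]setTI; apply: measurable_tnth => //.
  exact: measurable_ball.
by apply/seteqP; split=> [t H k _|t H k]; [exact: H|exact: (H k)].
Qed.

Lemma measurable_of_tuple_ball (z : ST) (r : R) : 0 < r ->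
  measurable (of_tuple @^-1` ball z r : set TT).
Proof.
move=> r0; rewrite of_tuple_ballE //.
rewrite (_ : [set _ | _] = [set t : d.-tuple R |
    forall k, ball (z.1 0 k) r (tnth t k)] `*` ball z.2 r).
  by apply: measurableX; [exact: measurable_tuple_box|exact: measurable_ball].
by [].
Qed.

(** The measurable structure on tuples is a product one, whereas openness is that of the normed
    space; they meet because an open set is a countable union of balls with rational centre and
    radius. *)
Lemma measurable_of_tuple_open (U : set ST) :
  open U -> measurable (of_tuple @^-1` U : set TT).
Proof.
move=> oU.
pose I := ('rV[rat]_d * rat * rat)%type.
pose c (i : I) : ST := (map_mx ratr i.1.1, ratr i.1.2).
pose F (i : I) : set TT :=
  if `[< 0 < ratr i.2 :> R /\ ball (c i) (ratr i.2) `<=` U >]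
  then of_tuple @^-1` ball (c i) (ratr i.2) else set0.
rewrite (_ : _ @^-1` _ = \bigcup_i F i).
  apply: countable_bigcupT_measurable => [|i]; first exact: countableP.
  rewrite /F.
  by case: asboolP => // -[i0 _]; exact: measurable_of_tuple_ball.
apply/seteqP; split=> [p /= Up|p [i _]]; last first.
  by rewrite /F; case: asboolP => // -[_ iU] /iU.
have /nbhs_ballP[e /= e0 eU] : nbhs (of_tuple p) U by exact: open_nbhs_nbhs.
(* A rational ball of radius below [e / 2] that contains the point stays inside its ball of radius
   [e]. *)
have [r re] : exists r : rat, 0 < (ratr r : R) < e / 2.
  have e2 : 0 < e / 2 by rewrite divr_gt0.
  by have [r] := rat_in_itvoo e2; rewrite in_itv /=; exists r.
move: re => /andP[r0 re].
have dense (x : R) : exists q : rat, `|ratr q - x| < ratr r.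
  have : x - ratr r < x + ratr r by lra.
  move=> /rat_in_itvoo[q]; rewrite in_itv /= => /andP[q1 q2]; exists q.
  by rewrite ltr_norml; apply/andP; split; lra.
have /choice[q hq] := fun k => dense (tnth p.1 k).
have [t ht] := dense p.2.
pose i : I := ((\row_k q k), t, r).
have pi : ball (c i) (ratr r) (of_tuple p).
  split; last exact: ht.
  by split=> // j k; rewrite !mxE; exact: hq.
exists i => //; rewrite /F; case: asboolP => // -[]; split=> // y iy.
apply: eU; have -> : e = e / 2 + e / 2 by rewrite -splitr.
apply: (@ball_triangle _ _ (c i)).
  by apply: ball_sym; apply: le_ball pi; exact: ltW.
by apply: le_ball iy; exact: ltW.
Qed.

Lemma measurable_of_tuple_closed (C : set ST) :
  closed C -> measurable (of_tuple @^-1` C : set TT).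
Proof.
move=> cC; rewrite -[C]setCK preimage_setC; apply: measurableC.
exact: (measurable_of_tuple_open (~` C) (closed_openC cC)).
Qed.

Lemma measurable_of_tuple_continuous (g : ST -> R) :
  continuous g -> measurable_fun [set: TT] (g \o of_tuple).
Proof.
move=> cg; apply: (measurability _ (RGenOpens.measurableE R)).
move=> _ [_ [a [b ->] <-]]; rewrite setTI comp_preimage.
apply: measurable_of_tuple_open; apply: open_comp; first by move=> z _; exact: cg.
exact: interval_open.
Qed.

Lemma measurable_cylinder (Omega : set 'rV[R]_d) (a b : R) :
  closed Omega -> measurable (cylinder Omega a b).
Proof.
move=> cO; rewrite (_ : cylinder Omega a b =
    of_tuple @^-1` (fst @^-1` Omega `&` snd @^-1` `[a, b])).
  apply: measurable_of_tuple_closed; apply: closedI.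
    by apply: preimage_closed => // z _; exact: cvg_fst.
  apply: preimage_closed; first by move=> z _; exact: cvg_snd.
  exact: interval_closed.
by apply/seteqP; split=> p /=; rewrite /cylinder /= in_itv.
Qed.

End TupleMeasurability.

(** * Lebesgue measure of balls in space-time *)

Section BoxMeasure.
Context {R : realType}.

Lemma lebesgue_tuple_box n (y : 'I_n -> R) (r : R) : 0 < r ->
  lebesgue_tuple n [set t | forall k, ball (y k) r (tnth t k)] =
  ((r *+ 2) ^+ n)%:E.
Proof.
move=> r0; elim: n y => [|n IH] y.
  by rewrite /= /dirac indicE mem_set // => -[].
rewrite /= /lebesgue_cons /pushforward.
rewrite (_ : _ @^-1` _ = ball (y ord0) r `*`
    [set t | forall k, ball (y (lift ord0 k)) r (tnth t k)]).
  rewrite product_measure1E; [|exact: measurable_ball|exact: measurable_tuple_box].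
  rewrite IH exprS EFinM; congr (_ * _)%E.
  exact: lebesgue_measure_ball (ltW r0).
apply/seteqP; split=> -[x t] /=.
  move=> H; split; first exact: (H ord0).
  by move=> k; have := H (lift ord0 k); rewrite tnthS.
move=> [H1 H2] k; case: (unliftP ord0 k) => [k' ->|->].
  by rewrite tnthS; exact: H2.
by rewrite tnth0.
Qed.

Lemma of_tuple_ball_measure {d} (z : spacetime R d) (r : R) : 0 < r ->
  (lebesgue_tuple d \x lebesgue_measure)%E (of_tuple @^-1` ball z r) =
  ((r *+ 2) ^+ d.+1)%:E.
Proof.
move=> r0; rewrite of_tuple_ballE //.
rewrite (_ : [set _ | _] = [set t : d.-tuple R |
    forall k, ball (z.1 0 k) r (tnth t k)] `*` ball z.2 r) //.
rewrite product_measure1E; [|exact: measurable_tuple_box|exact: measurable_ball].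
rewrite exprSr EFinM; congr (_ * _)%E; first exact: (lebesgue_tuple_box d (z.1 0)).
exact: lebesgue_measure_ball (ltW r0).
Qed.

End BoxMeasure.

(** * Estimates of L2 norms and of expectations *)

Section Lnorm2.
Context {dT : measure_display} {T : measurableType dT} {R : realType}.
Context (nu : {measure set T -> \bar R}).
Implicit Types f g h : T -> R.

Lemma Lnorm2E f :
  ('N[nu]_2%:E [EFin \o f] = sqrte (\int[nu]_x (f x ^+ 2)%:E))%E.
Proof.
rewrite unlock /Lnorm -poweR12_sqrt.
  congr (_ `^ _)%E; apply: eq_integral => x _ /=.
  by rewrite powR_mulrn // real_normK // num_real.
by apply: integral_ge0 => x _; rewrite lee_fin sqr_ge0.
Qed.

Lemma le_Lnorm2 f g : measurable_fun setT f -> measurable_fun setT g ->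
  (forall x, 0 <= f x <= g x) ->
  ('N[nu]_2%:E [EFin \o f] <= 'N[nu]_2%:E [EFin \o g])%E.
Proof.
move=> mf mg fg; rewrite !Lnorm2E lee_sqrt; last first.
  by apply: integral_ge0 => x _; rewrite lee_fin sqr_ge0.
apply: ge0_le_integral => //.
- by move=> x _; rewrite lee_fin sqr_ge0.
- by apply/measurable_EFinP; exact: measurable_funX.
- by apply/measurable_EFinP; exact: measurable_funX.
move=> x _; have /andP[f0 fgx] := fg x.
by rewrite lee_fin lerXn2r // nnegrE (le_trans f0).
Qed.

Lemma Lnorm2_triangle f g h : measurable_fun setT f -> measurable_fun setT g ->
  measurable_fun setT h -> (forall x, 0 <= f x <= g x + h x) ->
  ('N[nu]_2%:E [EFin \o f] <=
   'N[nu]_2%:E [EFin \o g] + 'N[nu]_2%:E [EFin \o h])%E.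
Proof.
move=> mf mg mh fgh.
apply: (le_trans (le_Lnorm2 f (g \+ h) mf (measurable_funD mg mh) fgh)).
by apply: minkowski_EFin => //; rewrite ler1n.
Qed.

(** The square root is there so that the squared function is a weighted sum of indicators,
    integrated by linearity. At a point of exactly one [A n] the function equals the absolute value
    of [c n]. *)
Lemma Lnorm2_sqrt_indic N (A : 'I_N -> set T) (c : 'I_N -> R) (v : R) :
  (forall n, measurable (A n)) -> (forall n, nu (A n) = v%:E) ->
  ('N[nu]_2%:E [EFin \o (fun x => Num.sqrt (\sum_n c n ^+ 2 * \1_(A n) x)%R)] =
   (Num.sqrt (v * \sum_n c n ^+ 2))%:E)%E.
Proof.
move=> mA vA; rewrite Lnorm2E.
have -> : (\int[nu]_x (Num.sqrt (\sum_n c n ^+ 2 * \1_(A n) x) ^+ 2)%:E =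
    \int[nu]_x (\sum_n (c n ^+ 2 * \1_(A n) x)%:E))%E.
  apply: eq_integral => x _; rewrite sqr_sqrtr ?sumEFin //.
  by apply: sumr_ge0 => n _; rewrite mulr_ge0 ?sqr_ge0.
rewrite ge0_integral_sum //; last 2 first.
- move=> n; apply/measurable_EFinP; apply: measurable_funM => //.
- by move=> n x _; rewrite lee_fin mulr_ge0 ?sqr_ge0.
rewrite (eq_bigr (fun n => (c n ^+ 2 * v)%:E)) => [|n _].
  by rewrite sumEFin -mulr_suml mulrC.
under eq_integral do rewrite EFinM.
rewrite ge0_integralZl_EFin ?sqr_ge0 //.
- by rewrite integral_indic // setIT vA.
- by apply/measurable_EFinP.
Qed.

(** Squared norms add up over a cover, so [N] pieces of norm at most [e] give a squared norm of at
    most [N * e ^+ 2]. *)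
Lemma Lnorm2_cover N (D : set T) (A : 'I_N -> set T) h (e : R) :
  measurable_fun setT (h \_ D) -> (forall n, measurable_fun setT (h \_ (A n))) ->
  D `<=` \bigcup_n A n -> 0 <= e ->
  (forall n, 'N[nu]_2%:E [EFin \o (h \_ (A n))] <= e%:E)%E ->
  ('N[nu]_2%:E [EFin \o (h \_ D)] <= (e * Num.sqrt N%:R)%:E)%E.
Proof.
move=> mD mA DA e0 le_e.
have int_le n : (\int[nu]_x ((h \_ (A n)) x ^+ 2)%:E <= (e ^+ 2)%:E)%E.
  have := le_e n; rewrite Lnorm2E.
  have : (0 <= \int[nu]_x ((h \_ (A n)) x ^+ 2)%:E)%E.
    by apply: integral_ge0 => x _; rewrite lee_fin sqr_ge0.
  case: (\int[nu]_x _)%E => [r||] //=; rewrite !lee_fin => r0 re.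
  by rewrite -(sqr_sqrtr r0) lerXn2r ?nnegrE ?sqrtr_ge0.
have : (\int[nu]_x ((h \_ D) x ^+ 2)%:E <= (N%:R * e ^+ 2)%:E)%E.
  apply: (@le_trans _ _
    (\int[nu]_x (\sum_(n < N) ((h \_ (A n)) x ^+ 2)%:E))%E).
    apply: ge0_le_integral => //.
    - by move=> x _; rewrite lee_fin sqr_ge0.
    - by apply/measurable_EFinP; exact: measurable_funX.
    - apply: emeasurable_sum => n.
      by apply/measurable_EFinP; exact: measurable_funX.
    move=> x _; rewrite sumEFin lee_fin {1}/patch; case: ifPn => [/set_mem/DA[n _ An]|_].
      rewrite (bigD1 n) //= {1}/patch mem_set // lerDl sumr_ge0 // => k _.
      by rewrite sqr_ge0.
    by rewrite expr0n /= sumr_ge0 // => k _; rewrite sqr_ge0.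
  rewrite ge0_integral_sum //; last 2 first.
  - by move=> n; apply/measurable_EFinP; exact: measurable_funX.
  - by move=> n x _; rewrite lee_fin sqr_ge0.
  apply: (@le_trans _ _ (\sum_(n < N) (e ^+ 2)%:E)%E); first exact: lee_sum.
  by rewrite sumEFin lee_fin sumr_const card_ord mulr_natl.
have : (0 <= \int[nu]_x ((h \_ D) x ^+ 2)%:E)%E.
  by apply: integral_ge0 => x _; rewrite lee_fin sqr_ge0.
rewrite Lnorm2E; case: (\int[nu]_x _)%E => [r||] //=; rewrite !lee_fin => r0 re.
by rewrite (le_trans (ler_wsqrtr re)) // sqrtrM // sqrtr_sqr ger0_norm // mulrC.
Qed.

(* [G] need not be measurable: the integral of a nonnegative function is the
   supremum of the integrals of the simple functions below it. *)
Lemma ge0_le_integral_nonmeasurable (g G : T -> \bar R) :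
  (forall x, 0 <= g x)%E -> (forall x, g x <= G x)%E ->
  (\int[nu]_x g x <= \int[nu]_x G x)%E.
Proof.
move=> g0 gG; rewrite !ge0_integralTE //; last first.
  by move=> x; exact: le_trans (g0 x) (gG x).
apply: le_ereal_sup => _ [f /= fg <-]; exists f => //= x.
exact: le_trans (fg x) (gG x).
Qed.

End Lnorm2.

(** The positive part of [a * |X| - e] is measurable, nonnegative and below [G]. Adding back the
    constant [e], whose integral under a probability is [e], dominates [a * |X|]. *)
Lemma integral_ge_affine {d : measure_display} {W : measurableType d} {R : realType}
    (P : probability W R) (X : {RV P >-> R}) (G : W -> \bar R) (a e mu : R) :
  ('E_P[fun w => `|X w|%R] = mu%:E)%E -> 0 <= a -> 0 <= e ->
  (forall w, 0 <= G w)%E -> (forall w, (a * `|X w|)%:E <= G w + e%:E)%E ->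
  ((a * mu - e)%:E <= \int[P]_w G w)%E.
Proof.
move=> EX a0 e0 G0 hG; pose g w := Num.max (a * `|X w| - e) 0.
have mX : measurable_fun setT (fun w => a * `|X w|).
  by apply: measurable_funM => //; exact: measurableT_comp.
have mg : measurable_fun setT g.
  by apply: measurable_maxr => //; exact: measurable_funB.
apply: (@le_trans _ _ (\int[P]_w (g w)%:E)%E); last first.
  apply: ge0_le_integral_nonmeasurable => w.
    by rewrite lee_fin le_max lexx orbT.
  rewrite /g maxEle; case: ifP => // _.
  by rewrite EFinB leeBlDr.
rewrite EFinB leeBlDr //.
have <- : (\int[P]_w (g w + e)%:E = \int[P]_w (g w)%:E + e%:E)%E.
  under eq_integral do rewrite EFinD.
  rewrite ge0_integralD //.
  - by rewrite integral_cst //= probability_setT mule1.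
  - by move=> w _; rewrite lee_fin le_max lexx orbT.
  - exact/measurable_EFinP.
rewrite EFinM -EX unlock -ge0_integralZl_EFin //; last first.
  by apply/measurable_EFinP; exact: measurableT_comp.
apply: ge0_le_integral => //.
- by move=> w _; rewrite -EFinM lee_fin mulr_ge0.
- exact/measurable_EFinP.
- by apply/measurable_EFinP; exact: measurable_funD.
by move=> w _; rewrite -EFinM lee_fin -lerBlDr le_max lexx.
Qed.

(** * The lower bound *)

Section BlockFunctions.
Context {R : realType} {d J : nat}.
Local Notation ST := (spacetime R d).
Context (S : rfm R d J) (tau0 : 0 < tau S)
  (cphi : forall n j, continuous (phi S n j)).

Lemma phi_shift n j (z : ST) :
  phi S n j z = phi S 0 j (z.1, z.2 - n%:R * tau S).
Proof.
rewrite /phi /=; congr eval_feature; rewrite /tmap mul0r subr0 //.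
Qed.

(** The blocks are closed here so that the final time is covered as well. *)
Lemma block_cover N (t : R) : (0 < N)%N -> 0 <= t -> t <= N%:R * tau S ->
  exists2 n, (n < N)%N & n%:R * tau S <= t <= n.+1%:R * tau S.
Proof.
case: N => // N _ t0; elim: N => [|N IH] tN.
  by exists 0%N => //; rewrite mul0r t0 tN.
have [tN'|tN'] := leP t (N.+1%:R * tau S).
  by have [n nN nt] := IH tN'; exists n => //; exact: ltnW.
by exists N.+1 => //; rewrite (ltW tN').
Qed.

Lemma uM_block Nt (c : nat -> 'cV[R[i]]_J) n (z : ST) : (n < Nt)%N ->
  n%:R * tau S <= z.2 < n.+1%:R * tau S ->
  uM S Nt c z = \sum_j c n j 0 * (phi S n j z)%:C%C.
Proof.
move=> nN /andP[nz zn]; rewrite /uM (bigD1 (Ordinal nN)) //= [X in _ + X]big1.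
  by rewrite indicE mem_set /= ?in_itv /= ?nz // mul1r addr0.
move=> i ni; rewrite indicE memNset ?mul0r //= in_itv /= => /andP[iz zi].
have := le_lt_trans iz zn; rewrite ltr_pM2r // ltr_nat ltnS => i_n.
have := le_lt_trans nz zi; rewrite ltr_pM2r // ltr_nat ltnS => n_i.
by case/eqP: ni; apply: val_inj => /=; apply/eqP; rewrite eqn_leq i_n n_i.
Qed.

Lemma measurable_normc (D : set (d.-tuple R * R)) (f : d.-tuple R * R -> R[i]) :
  measurable_fun D (fun p => complex.Re (f p)) ->
  measurable_fun D (fun p => complex.Im (f p)) ->
  measurable_fun D (fun p => normc (f p)).
Proof.
move=> mr mi.
rewrite (_ : (fun _ => _) = Num.sqrt \o
  (fun p => complex.Re (f p) ^+ 2 + complex.Im (f p) ^+ 2)).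
  apply: (measurableT_comp (continuous_measurable_fun (@sqrt_continuous R))).
  by apply: measurable_funD; exact: measurable_funX.
by apply/funext => p /=; case: (f p).
Qed.

Lemma measurable_uM_error (D : set (d.-tuple R * R)) Nt (c : nat -> 'cV[R[i]]_J)
    (ue : ST -> R) :
  measurable D -> measurable_fun D (ue \o of_tuple) ->
  measurable_fun setT ((fun p => normc (uM S Nt c (of_tuple p) -
    (ue (of_tuple p))%:C%C)) \_ D).
Proof.
move=> mD mue; apply: (measurable_restrictT _ mD).1.
(* An arbitrary real-linear [h] treats the real and the imaginary part at once. *)
have mblock (h : R[i] -> R) : (forall x y, h (x + y) = h x + h y) -> h 0 = 0 ->
    (forall (x : R) y, h (x%:C%C * y) = x * h y) ->
    measurable_fun D (fun p => h (uM S Nt c (of_tuple p))).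
  move=> hD h0 hM.
  have hsum n (F : 'I_n -> R[i]) : h (\sum_i F i) = \sum_i h (F i).
    by rewrite (big_morph h hD h0).
  rewrite (_ : (fun _ => _) = (fun p : d.-tuple R * R => \sum_(n < Nt)
      \1_(`[n%:R * tau S, n.+1%:R * tau S[) p.2 *
      \sum_j phi S n j (of_tuple p) * h (c n j 0))).
    apply: measurable_sum => n; apply: measurable_funM.
      have mI : measurable_fun setT
          (\1_(`[n%:R * tau S, n.+1%:R * tau S[ : set R) : R -> R).
        exact: measurable_indic.
      exact: (measurableT_comp mI (measurable_funTS measurable_snd)).
    apply: measurable_sum => j; apply: measurable_funM => //.
    apply: measurable_funTS; exact: measurable_of_tuple_continuous.
  apply/funext => p; rewrite /uM hsum; apply: eq_bigr => n _.
  rewrite hM hsum; congr (_ * _); apply: eq_bigr => j _.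
  by rewrite mulrC hM.
apply: (measurable_normc D
  (fun p => uM S Nt c (of_tuple p) - (ue (of_tuple p))%:C%C)).
  rewrite (_ : (fun _ => _) = (fun p => complex.Re (uM S Nt c (of_tuple p))) \-
    (ue \o of_tuple)).
    apply: measurable_funB => //; apply: mblock => //.
    - by move=> [? ?] [? ?].
    - by move=> x [y1 y2] /=; rewrite mul0r subr0.
  by apply/funext => p /=; case: (uM _ _ _ _).
rewrite (_ : (fun _ => _) = (fun p => complex.Im (uM S Nt c (of_tuple p)))).
  apply: mblock => //.
  - by move=> [? ?] [? ?].
  - by move=> x [y1 y2] /=; rewrite mul0r addr0.
by apply/funext => p /=; case: (uM _ _ _ _) => x y /=; rewrite oppr0 addr0.
Qed.

Lemma L2normE (Omega : set 'rV[R]_d) (a b : R) (f : ST -> R[i]) :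
  L2norm Omega a b f =
  ('N[(lebesgue_tuple d \x lebesgue_measure)%E]_2%:E
    [EFin \o ((fun p => normc (f (of_tuple p))) \_ (cylinder Omega a b))])%E.
Proof.
rewrite /L2norm; congr (Lnorm _ _ _); apply/funext => p /=.
by rewrite /patch; case: ifP.
Qed.

(** Here [c] stands for the perturbed and [c'] for the exact block coefficients. Each block contains
    a ball on which the two functions differ by at least [m n]; the step function with these heights
    is below the sum of the distances of both functions to [ue], and Minkowski's inequality
    separates the two. *)
Lemma L2norm_lower_bound (Omega : set 'rV[R]_d) (i0 : 'I_J) (z : 'I_J -> ST)
    (r c0 : R) Nt (c c' : nat -> 'cV[R[i]]_J) (ue : ST -> R) (eps : R) :
  (0 < Nt)%N -> closed Omega -> 0 < r -> 0 < c0 ->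
  (forall i, ball (z i) r `<=` [set y | Omega° y.1 /\ 0 < y.2 < tau S]) ->
  (forall e : 'I_J -> R[i], exists i, forall y, ball (z i) r y ->
      c0 * \sum_j normc (e j) <= normc (\sum_j e j * (phi S 0 j y)%:C%C)) ->
  measurable_fun (cylinder Omega 0 (Nt%:R * tau S)) (ue \o of_tuple) ->
  0 <= eps ->
  (forall n, (n < Nt)%N ->
    (L2norm Omega (n%:R * tau S) (n.+1%:R * tau S)
      (fun y => uM S Nt c' y - (ue y)%:C%C)%R <= eps%:E)%E) ->
  ((Num.sqrt ((r *+ 2) ^+ d.+1 *
     \sum_(n < Nt) (c0 * \sum_j normc ((c n - c' n) j 0)) ^+ 2))%:E <=
   L2norm Omega 0 (Nt%:R * tau S) (fun y => uM S Nt c y - (ue y)%:C%C)%R +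
   (eps * Num.sqrt Nt%:R)%:E)%E.
Proof.
move=> Nt0 cO r0 c00 zX zlow mue eps0 hblock.
have mcyl a b : measurable (cylinder Omega a b) by exact: measurable_cylinder.
pose m n := c0 * \sum_j normc ((c n - c' n) j 0).
have m0 n : 0 <= m n.
  by rewrite mulr_ge0 ?(ltW c00) // sumr_ge0 // => j _; exact: normc_ge0.
(* In each block the ball is the one suited to the coefficient difference of that block, translated
   in time from block 0. *)
have /choice[idx hidx] n := zlow (fun j => (c n - c' n) j 0).
pose ctr n : ST := ((z (idx n)).1, (z (idx n)).2 + n%:R * tau S).
pose A (n : 'I_Nt) : set (d.-tuple R * R) := of_tuple @^-1` ball (ctr n) r.
have Ashift n p : ball (ctr n) r (of_tuple p) ->
    ball (z (idx n)) r ((of_tuple p).1, p.2 - n%:R * tau S).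
  move=> [b1 b2]; split=> //; rewrite /ball /=.
  by have -> : (z (idx n)).2 - (p.2 - n%:R * tau S) = (ctr n).2 - p.2
    by [rewrite /ctr /=; ring].
have Atime n p : ball (ctr n) r (of_tuple p) ->
    Omega° (of_tuple p).1 /\ n%:R * tau S < p.2 < n.+1%:R * tau S.
  move=> /Ashift/zX[/= Op /andP[t1 t2]]; split=> //.
  by rewrite -natr1 mulrDl mul1r; apply/andP; split; lra.
have Alow n p : (n < Nt)%N -> ball (ctr n) r (of_tuple p) ->
    m n <= normc (uM S Nt c (of_tuple p) - uM S Nt c' (of_tuple p)).
  move=> nN Anp; have [_ /andP[t1 t2]] := Atime n p Anp.
  rewrite !(uM_block _ _ n) //=; try by rewrite (ltW t1) t2.
  rewrite -sumrB; apply: le_trans (hidx n _ (Ashift n p Anp)) _.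
  rewrite le_eqVlt; apply/orP; left; apply/eqP; congr normc.
  apply: eq_bigr => j _; rewrite !mxE (phi_shift n) /=; ring.
have mA n : measurable (A n) by exact: measurable_of_tuple_ball.
pose nu : {measure set (d.-tuple R * measurableTypeR R) -> \bar R} :=
  (lebesgue_tuple d \x @lebesgue_measure R)%E.
have vA n : nu (A n) = ((r *+ 2) ^+ d.+1)%:E by exact: of_tuple_ball_measure.
rewrite -(Lnorm2_sqrt_indic nu _ A (fun n : 'I_Nt => m n) _ mA vA).
pose h (cc : nat -> 'cV[R[i]]_J) p :=
  normc (uM S Nt cc (of_tuple p) - (ue (of_tuple p))%:C%C).
have mh cc a b : 0 <= a -> b <= Nt%:R * tau S ->
    measurable_fun setT (h cc \_ (cylinder Omega a b)).
  move=> a0 bT; apply: measurable_uM_error => //.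
  apply: measurable_funS mue => // p [Op /andP[ap pb]]; split=> //.
  by rewrite (le_trans a0 ap) (le_trans pb bT).
have cover : (L2norm Omega 0 (Nt%:R * tau S) (fun y => uM S Nt c' y - (ue y)%:C%C)%R
    <= (eps * Num.sqrt Nt%:R)%:E)%E.
  rewrite L2normE.
  apply: (Lnorm2_cover nu Nt _
    (fun n : 'I_Nt => cylinder Omega (n%:R * tau S) (n.+1%:R * tau S)) (h c')).
  - exact: mh.
  - move=> n; apply: mh; first by rewrite mulr_ge0 // ltW.
    by rewrite ler_pM2r // ler_nat.
  - move=> p [Op /andP[p0 pT]].
    have [n nN pn] := block_cover _ _ Nt0 p0 pT.
    by exists (Ordinal nN).
  - exact: eps0.
  - by move=> n; have := hblock n (ltn_ord n); rewrite L2normE.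
apply: le_trans (leeD2l _ cover); rewrite !L2normE.
apply: (Lnorm2_triangle nu).
- have mS : measurable_fun setT 
      (fun p : d.-tuple R * R => \sum_(n < Nt) m n ^+ 2 * \1_(A n) p : R).
    apply: measurable_sum => n; apply: measurable_funM => //.
  exact: (measurableT_comp (continuous_measurable_fun (@sqrt_continuous R)) mS).
- exact: mh.
- exact: mh.
move=> p; rewrite sqrtr_ge0 /=.
have hpos cc D : 0 <= (h cc \_ D) p.
  by rewrite /patch; case: ifP => // _; exact: normc_ge0.
(* Off the balls the step function is zero. The balls lie in the interiors of different time blocks,
   so at most one indicator is nonzero. *)
have [[n An]|nA] := pselect (exists n : 'I_Nt, A n p); last first.
  rewrite big1 => [|n _]; first by rewrite sqrtr0 addr_ge0 //; exact: hpos.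
  by rewrite indicE memNset ?mulr0 // => An; apply: nA; exists n.
have [Op /andP[t1 t2]] := Atime _ _ An.
have uniq k : k != n -> ~ A k p.
  move=> kn Ak; have [_ /andP[s1 s2]] := Atime _ _ Ak.
  have := lt_trans s1 t2; rewrite ltr_pM2r // ltr_nat ltnS => k_n.
  have := lt_trans t1 s2; rewrite ltr_pM2r // ltr_nat ltnS => n_k.
  by case/eqP: kn; apply: val_inj => /=; apply/eqP; rewrite eqn_leq k_n n_k.
rewrite (bigD1 n) //= [X in _ + X]big1 => [|k kn]; last first.
  by rewrite indicE memNset ?mulr0 //; exact: uniq.
rewrite indicE mem_set // mulr1 addr0 sqrtr_sqr ger0_norm //.
have cylp : p \in cylinder Omega 0 (Nt%:R * tau S).
  apply/mem_set; split; first exact: interior_subset Op.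
  rewrite (le_trans _ (ltW t1)) ?mulr_ge0 ?(ltW tau0) //=.
  by rewrite (le_trans (ltW t2)) // ler_pM2r // ler_nat.
rewrite /patch cylp (le_trans (Alow _ _ (ltn_ord n) An)) //.
rewrite /h -[X in _ <= _ + X]normcN (le_trans _ (le_normcD _ _)) //.
by rewrite opprB addrA subrK.
Qed.

End BlockFunctions.

Theorem theorem2p12 (R : realType) (d J : nat) (hd : (0 < d)%N)
  (Omega : set 'rV[R]_d) (hOc : compact Omega)
  (hOr : closure (Omega°) = Omega)
  (S : rfm R d J) (htau : 0 < tau S)
  (hl : forall x, Omega x -> forall k, -1 <= xmap S x 0 k <= 1)
  (pb : nat -> problem R d)
  (hcol : forall Nt, (0 < Nt)%N ->
    forall n, (n < Nt)%N -> collocation Omega (tau S) (pb Nt) n)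
  (hsigma : forall Nt, (0 < Nt)%N ->
    Cn_regular (diffop_order (oper (pb Nt))) (sigma S))
  (hA : forall Nt, (0 < Nt)%N -> forall n, (n < Nt)%N ->
    (Atilde S (pb Nt) n)^T *m Atilde S (pb Nt) n \in unitmx)
  (B : 'M[R]_J)
  (hB : forall Nt, (0 < Nt)%N ->
    forall n, (n.+1 < Nt)%N -> Bmat S (pb Nt) n = B)
  (lam : 'I_J -> R[i]) (b : 'I_J -> 'cV[R[i]]_J)
  (hlam : orthonormal_eigenbasis B lam b)
  (m : 'I_J) (hm : forall k, normc (lam k) <= normc (lam m))
  (dW : measure_display) (W : measurableType dW) (P : probability W R)
  (du : 'I_J -> {RV P >-> R})
  (hind : independent_family du) (hid : identically_distributed du)
  (mu delta : R) (hmu : 0 < mu) (hdelta : 0 < delta ^+ 2)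
  (hE0 : forall k, ('E_P[du k] = 0)%E)
  (hE1 : forall k, ('E_P[fun w => `|du k w|%R] = mu%:E)%E)
  (hE2 : forall k, ('E_P[fun w => (du k w ^+ 2)%R] = (delta ^+ 2)%:E)%E)
  (uB : nat -> nat -> 'cV[R]_J)
  (huB : forall Nt, (0 < Nt)%N -> block_time_marching S Nt (pb Nt) (uB Nt))
  (ue : nat -> spacetime R d -> R)
  (hue : forall Nt, (0 < Nt)%N ->
    exact_solution Omega (Nt%:R * tau S) (pb Nt) (ue Nt))
  (eps : R) (heps : 0 < eps)
  (happrox : forall Nt, (0 < Nt)%N -> forall n, (n < Nt)%N ->
    (L2norm Omega (n%:R * tau S) (n.+1%:R * tau S)
      (fun z => (uM S Nt (fun i => toC (uB Nt i)) z - (ue Nt z)%:C%C)%R)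
      <= eps%:E)%E) :
  exists N : nat, exists alpha : R, [/\ (0 < N)%N, 0 < alpha &
    forall Nt, (N < Nt)%N ->
    ((alpha * mu * Num.sqrt Nt%:R * beta lam m Nt%:R
        - eps * Num.sqrt Nt%:R)%:E
     <= \int[P]_w L2norm Omega 0 (Nt%:R * tau S)
          (fun z => (uM S Nt (uhat S (pb Nt) (uB Nt)
                       (\sum_(k < J) (du k w)%:C%C *: b k)) z
                     - (ue Nt z)%:C%C)%R))%E].

Proof.
(* The features are the same for all [Nt], so the problem with a single block already gives their
   regularity and independence. The ball radius and the constants are thus fixed before [Nt]. *)
have [sig0 Nt1] : Cn_regular (diffop_order (oper (pb 1%N))) (sigma S) /\ (0 < 1)%N.
  by split=> //; exact: hsigma.
have cphi n j : continuous (phi S n j).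
  exact: partial_regular_continuous (partial_regular_phi _ S n j sig0).
have cO : closed Omega by apply: compact_closed => //; exact: norm_hausdorff.
have indep (v : 'cV[R]_J) :
    (forall y, Omega° y.1 /\ 0 < y.2 < tau S -> \sum_j v j 0 * phi S 0 j y = 0) ->
    v = 0.
  by apply: (features_independent Omega S (pb 1%N)) => //; [exact: hcol|exact: hA].
have [z [r [c0 [r0 c00 zX zlow]]]] := independent_local_lower_bound
  [set y | Omega° y.1 /\ 0 < y.2 < tau S] (phi S 0) m
  (open_spacetime_interior _ _) (cphi 0%N) indep.
have [N0 [a [k [N00 a0 grow]]]] := energy_growth lam m hm.
have [hBb hb] := hlam.
pose Cb := 1 + \sum_i normc (b k i 0).
have Cb0 : 0 < Cb.
  by rewrite ltr_pwDl // sumr_ge0 // => i _; exact: normc_ge0.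
pose v := (r *+ 2) ^+ d.+1.
have v0 : 0 < v by rewrite exprn_gt0 // pmulrn_lgt0.
(* [v] is the measure of a ball, [a] the growth constant of the energy, [c0] the lower bound for the
   features, and [Cb] the cost of reading one eigencoordinate off the coefficient entries. *)
pose alpha := Num.sqrt (v * a) * (c0 / Cb).
have alpha0 : 0 < alpha.
  by apply: mulr_gt0; rewrite ?sqrtr_gt0 ?mulr_gt0 ?invr_gt0.
exists N0, alpha; split=> // Nt N0Nt.
have Nt0 : (0 < Nt)%N by exact: leq_ltn_trans N0Nt.
have beta0 : 0 <= beta lam m Nt%:R.
  by rewrite /beta; case: ifP => // _; case: ifP => // _; exact: powR_ge0.
have rate0 : 0 <= alpha * Num.sqrt Nt%:R * beta lam m Nt%:R.
  apply: mulr_ge0 => //; apply: mulr_ge0; last exact: sqrtr_ge0.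
  exact: ltW.
rewrite (_ : alpha * mu * _ * _ = alpha * Num.sqrt Nt%:R * beta lam m Nt%:R * mu);
  last by ring.
(* It remains to bound the norm for each outcome [w] by means of the single coordinate [du k w]. *)
apply: (integral_ge_affine P (du k)) => //.
- by rewrite mulr_ge0 ?sqrtr_ge0 // ltW.
- by move=> w; exact: Lnorm_ge0.
move=> w; have [mue _ _ _] := hue Nt Nt0.
set U := uhat _ _ _ _.
apply: le_trans (L2norm_lower_bound S htau cphi Omega m z r c0 Nt U
  (fun n => toC (uB Nt n)) (ue Nt) eps Nt0 cO r0 c00 zX zlow mue (ltW heps)
  (happrox Nt Nt0)).
rewrite lee_fin -/v.
have coord n : (n < Nt)%N -> c0 / Cb * (`|du k w| * normc (geometric_sum (lam k) n)) <=
    c0 * \sum_j normc ((U n - toC (uB Nt n)) j 0).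
  move=> nN; rewrite -mulrA ler_pM2l // [leLHS]mulrC ler_pdivrMr // [leRHS]mulrC.
  have := uhat_error S (pb Nt) (uB Nt) Nt B lam b (fun l => (du l w)%:C%C)
    (hA Nt Nt0) (hB Nt Nt0) hBb (huB Nt Nt0) n nN.
  rewrite -/U => ->; rewrite -normc_real -normcM.
  exact: (orthonormal_coord_le b (fun l => (du l w)%:C%C * geometric_sum (lam l) n)
    k hb).
have sum_ge : (c0 / Cb * `|du k w|) ^+ 2 * (a * Nt%:R * beta lam m Nt%:R ^+ 2) <=
    \sum_(n < Nt) (c0 * \sum_j normc ((U n - toC (uB Nt n)) j 0)) ^+ 2.
  apply: (@le_trans _ _ ((c0 / Cb * `|du k w|) ^+ 2 *
      \sum_(n < Nt) normc (geometric_sum (lam k) n) ^+ 2)).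
    by rewrite ler_wpM2l ?sqr_ge0 // grow.
  rewrite mulr_sumr ler_sum // => n _; rewrite -exprMn -(mulrA (c0 / Cb)).
  have x0 : 0 <= c0 / Cb * (`|du k w| * normc (geometric_sum (lam k) n)).
    by rewrite !mulr_ge0 ?invr_ge0 ?normc_ge0 ?(ltW Cb0) ?(ltW c00).
  have x1 := coord n (ltn_ord n).
  by apply: lerXn2r => //; exact: le_trans x0 x1.
apply: le_trans (ler_wsqrtr (ler_wpM2l (ltW v0) sum_ge)).
have lhs0 : 0 <= alpha * Num.sqrt Nt%:R * beta lam m Nt%:R * `|du k w|.
  exact: mulr_ge0.
(* The nonnegative left side is the root of its square, and the two radicands are equal. *)
rewrite -(ger0_norm lhs0) -sqrtr_sqr ler_wsqrtr // le_eqVlt; apply/orP; left.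
apply/eqP; rewrite /alpha !exprMn !sqr_sqrtr ?mulr_ge0 ?(ltW a0) ?(ltW v0) //.
ring.
Qed.
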